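(* For every graph $G$ with maximum degree at most $3$ (a subcubic graph), $\chi'_{inj}(G)\le 7$.
   Context: All graphs are finite and simple. An edge coloring of a graph $G$ (not necessarily proper) is \emph{injective} if any two distinct edges $e,f$ receive distinct colors whenever either (i) $e$ and $f$ share no vertex and some edge of $G$ joins an endpoint of $e$ to an endpoint of $f$ (i.e., $e,f$ are at distance exactly $1$), or (ii) $e$ and $f$ lie in a common triangle of $G$. The injective chromatic index $\chi'_{inj}(G)$ is the minimum number of colors in an injective edge coloring of $G$. *)

(* Defs.v *)
From mathcomp Require Import all_boot.
Set Implicit Arguments. Unset Strict Implicit. Unset Printing Implicit Defensive.

Definition simple_graph (T : finType) (g : rel T) : Prop :=
  symmetric g /\ irreflexive g.

Definition is_edge (T : finType) (g : rel T) (E : {set T}) : bool :=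
  [exists u, exists v, g u v && (E == [set u; v])].

Definition degree (T : finType) (g : rel T) (v : T) : nat := #|[set u | g v u]|.

Definition max_degree_le (T : finType) (g : rel T) (D : nat) : Prop :=
  forall v : T, degree g v <= D.

Definition edges_dist1 (T : finType) (g : rel T) (e f : {set T}) : bool :=
  [disjoint e & f] && [exists u in e, exists v in f, g u v].

Definition in_common_triangle (T : finType) (g : rel T) (e f : {set T}) : bool :=
  [exists x, exists y, exists z,
     [&& g x y, g y z, g x z &
        (e \subset [set x; y; z]) && (f \subset [set x; y; z])]].

(* An edge colouring with k colours: a map from edges (vertex pairs) to 'I_k;
   only its values on edges matter. *)
Definition injective_edge_coloring (T : finType) (g : rel T) (k : nat)
    (c : {set T} -> 'I_k) : Prop :=
  forall e f : {set T}, is_edge g e -> is_edge g f -> e != f ->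
    (edges_dist1 g e f || in_common_triangle g e f) -> c e != c f.

Definition inj_chromatic_index_le (T : finType) (g : rel T) (k : nat) : Prop :=
  exists c : {set T} -> 'I_k, injective_edge_coloring g c.

(* Main.v *)
(** Two edges conflict when they are the end edges of a path x-a-b-y, with x = y allowed; an
    injective edge colouring is exactly a proper colouring of this conflict graph H, whose
    maximum degree is at most 8.  A Lovasz partition of the vertices of H into V1 and V2, where
    H[V1] has maximum degree 3 and H[V2] has maximum degree 4, together with Brooks' theorem on
    both parts, gives 3 + 4 = 7 colours unless H[V1] contains a 4-clique or H[V2] a 5-clique.
    Vertices of degree at most 6 are coloured last.  A triangle of G together with its pendant
    edges forms a prism in H whose six vertices have degree at most 7, and the prism is
    3-choosable; hence the edges that matter lie in no triangle and conflicting ones are disjoint.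
    In an optimal partition a 5-clique in V2 is then impossible, and a 4-clique in V1 consists
    of edges of degree 8, which forces four edges hanging off a 4-cycle of G; there one clique
    edge is moved to the colours of V2 in exchange for two edges of the 4-cycle. *)

Require Import Defs.
From mathcomp Require Import all_boot zify.
Set Implicit Arguments. Unset Strict Implicit. Unset Printing Implicit Defensive.

(** Degree 8 in H allows parts whose degrees sum to 7, and the split 3 + 4 keeps both parts within
    reach of Brooks' theorem, which needs at least three colours. The obstacle is a 4-clique in
    H[V1]: optimality does not exclude it. Each of its members has exactly three conflicts in V1 and
    five in V2, so three colours are too few for the clique and all four colours of V2 may be
    blocked. Moving one member e to the colours of V2 is possible once two of its five neighbours
    there give up those colours; they must then share one colour of V1. The two sides of the 4-cycle
    at the corner opposite to e can do this: they do not conflict with each other or with the clique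
    edge at that corner. Several 4-cliques may have to be repaired in turn. The exchanges do not
    disturb each other, because a conflict of a moved side is either a conflict of the clique as
    well or one of two edges joining the outer ends of opposite clique edges, and these two have no
    conflict in V1. *)

Ltac side := first [done | by rewrite eq_sym
  | match goal with H : symmetric ?g |- is_true (?g _ _) => by rewrite H end].

(** * Colourings and Brooks' theorem *)

Section Coloring.
Variables (V : finType) (h : rel V).
Hypotheses (h_sym : symmetric h) (h_irr : irreflexive h).

Definition nbh x : {set V} := [set y | h x y].

Definition coloring (C : eqType) (X : {set V}) (c : V -> C) : Prop :=
  forall x y, x \in X -> y \in X -> h x y -> c x != c y.

Definition clique (K : {set V}) : Prop :=
  forall x y, x \in K -> y \in K -> x != y -> h x y.

Lemma coloring_sub (C : eqType) (X Y : {set V}) (c : V -> C) :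
  X \subset Y -> coloring Y c -> coloring X c.
Proof. by move=> /subsetP sXY pc x y /sXY xY /sXY yY; apply: pc. Qed.

Lemma coloring_setU (C : eqType) (X Y : {set V}) (c d : V -> C) :
  coloring X c -> coloring Y d ->
  (forall x y, x \in X -> y \in Y -> x \notin Y -> h x y -> c x != d y) ->
  coloring (X :|: Y) (fun z => if z \in Y then d z else c z).
Proof.
move=> pc pd cd x y; rewrite !inE; case: ifP => xY; case: ifP => yY; rewrite ?orbT ?orbF.
- by move=> _ _; apply: pd.
- by move=> _ yX hxy; rewrite eq_sym; apply: cd; rewrite ?yY // h_sym.
- by move=> xX _; apply: cd; rewrite ?xY.
- exact: pc.
Qed.

(** The bound is on the image and not on [B], so that two members of [B] sharing a colour save one;
    this is how the last vertex is coloured in Brooks' theorem. *)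
Lemma free_color (C : finType) (c : V -> C) (B : {set V}) :
  #|c @: B| < #|C| -> exists i, forall y, y \in B -> c y != i.
Proof.
move=> lt; have /card_gt0P[i] : 0 < #|~: (c @: B)| by rewrite cardsCs setCK; lia.
by rewrite inE => iB; exists i => y yB; apply: contraNneq iB => <-; apply: imset_f.
Qed.

Lemma coloring_extend (C : finType) (X : {set V}) (c : V -> C) v :
  coloring X c -> #|c @: (nbh v :&: X)| < #|C| ->
  exists2 c', coloring (v |: X) c' & {in X :\ v, c' =1 c}.
Proof.
move=> pc /free_color[i ci].
exists (fun z => if z \in [set v] then i else c z); last first.
  by move=> z; rewrite !inE => /andP[/negPf-> _].
rewrite setUC; apply: (coloring_setU pc (d := fun=> i)).
  by move=> x y /set1P-> /set1P->; rewrite h_irr.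
by move=> x y xX /set1P-> _ hxv; apply: ci; rewrite !inE h_sym hxv.
Qed.

Lemma card_imset_pair (C : finType) (c : V -> C) (B : {set V}) x y :
  x \in B -> y \in B -> x != y -> c x = c y -> #|c @: B| < #|B|.
Proof.
move=> xB yB xy cxy; rewrite (cardsD1 x B) xB ltnS.
apply: leq_trans (leq_imset_card c (B :\ x)); apply: subset_leq_card.
apply/subsetP => _ /imsetP[z zB ->]; have [->|zx] := eqVneq z x.
  by rewrite cxy imset_f // !inE eq_sym xy.
by rewrite imset_f // !inE zx.
Qed.

Section Brooks.
Variable k : nat.

(** Greedy colouring along a path: when a vertex is reached, its successor is still uncoloured, so
    at most [k - 1] of its neighbours have a colour. The last vertex has no successor and is left
    out by [belast]. *)
Lemma path_color (C : finType) (A : {set V}) :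
  #|C| = k -> (forall v, v \in A -> #|nbh v :&: A| <= k) ->
  forall (s : seq V) x (B : {set V}) (c : V -> C),
  coloring B c -> path h x s -> uniq (x :: s) -> {subset x :: s <= A} ->
  B \subset A -> (forall y, y \in x :: s -> y \notin B) ->
  exists2 c', coloring (B :|: [set y in belast x s]) c' & {in B, c' =1 c}.
Proof.
move=> Ck dA; elim=> [|y s IHs] x B c pc /=.
  by move=> *; exists c => // ; apply: coloring_sub pc; apply/subsetP=> z; rewrite !inE orbF.
move=> /andP[hxy pys] /andP[xys uys] sA sBA dB.
have xA : x \in A by rewrite sA // inE eqxx.
have yA : y \in A by rewrite sA // !inE eqxx orbT.
have yB : y \notin B by rewrite dB // !inE eqxx orbT.
have xB : x \notin B by rewrite dB // !inE eqxx.
have lt : #|c @: (nbh x :&: B)| < #|C|.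
  rewrite Ck; apply: leq_ltn_trans (leq_imset_card _ _) _.
  apply: leq_trans (dA x xA); apply: proper_card; apply/properP; split.
    exact: setIS.
  by exists y; rewrite !inE hxy ?yA ?(negPf yB).
have [c1 pc1 e1] := coloring_extend pc lt.
have [|||c2 pc2 e2] := IHs y _ _ pc1 pys uys.
- by move=> z zs; apply: sA; rewrite inE zs orbT.
- by apply/subsetP=> z /setU1P[->//|/(subsetP sBA)].
- move=> z zs; rewrite !inE negb_or dB ?andbT; last by rewrite inE zs orbT.
  by apply: contraNneq xys => <-.
exists c2; first by apply: coloring_sub pc2; apply/subsetP=> z; rewrite !inE orbCA orbA.
move=> z zB; rewrite e2 ?inE ?zB ?orbT // e1 // !inE zB andbT.
by apply: contraNneq xB => <-.
Qed.

(** The beginning of the path is prescribed; it is maximal at its far end only. *)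
Lemma maximal_path (A : {set V}) x s :
  path h x s -> uniq (x :: s) -> {subset x :: s <= A} ->
  exists t, [/\ path h x (s ++ t), uniq (x :: s ++ t), {subset x :: s ++ t <= A}
    & forall y, y \in A -> h (last x (s ++ t)) y -> y \in x :: s ++ t].
Proof.
have [n] := ubnP (#|A| - size s); elim: n s => // n IHn s lt ps us sA.
have [/existsP[y /and3P[yA hy ys]]|/existsPn none] :=
  boolP [exists y, [&& y \in A, h (last x s) y & y \notin x :: s]].
  have us' : uniq (x :: rcons s y) by rewrite -rcons_cons rcons_uniq ys.
  have sA' : {subset x :: rcons s y <= A}.
    by move=> z; rewrite -rcons_cons mem_rcons inE => /orP[/eqP->|/sA].
  have leA : size (x :: rcons s y) <= #|A|.
    by rewrite -(card_uniqP us'); apply: subset_leq_card; apply/subsetP.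
  have [||t] := IHn (rcons s y) _ _ us' sA'.
  - by move: lt leA; rewrite /= size_rcons; lia.
  - by rewrite rcons_path ps.
  by rewrite cat_rcons; exists (y :: t).
exists nil; rewrite cats0; split=> // y yA hy; apply: contraNT (none y) => ys.
by rewrite yA hy.
Qed.

Lemma split_last_has (p : pred V) (t : seq V) :
  has p t -> exists t1 b t2, [/\ t = t1 ++ b :: t2, p b & all (predC p) t2].
Proof.
elim/last_ind: t => // t y IHt; rewrite has_rcons.
have [py _|npy /= /IHt[t1 [b [t2 [-> pb at2]]]]] := boolP (p y).
  by exists t, y, nil; rewrite cats1.
by exists t1, b, (rcons t2 y); rewrite all_rcons /= npy rcons_cat rcons_cons.
Qed.

(** Going round from [m], the last vertex satisfying [p] is followed cyclically by one that fails
    it, possibly [m] itself; the cycle is cut between these two. *)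
Lemma cycle_boundary (p : pred V) (s : seq V) m :
  cycle h s -> uniq s -> m \in s -> ~~ p m -> has p s ->
  exists a t, [/\ cycle h (a :: t), uniq (a :: t), a :: t =i s, ~~ p a & p (last a t)].
Proof.
move=> cs us ms npm ps; have [i t e] := rot_to ms.
have ct : cycle h (m :: t) by rewrite -e rot_cycle.
have ut : uniq (m :: t) by rewrite -e rot_uniq.
have mt : m :: t =i s by move=> z; rewrite -e mem_rot.
have : has p t.
  case/hasP: ps => z; rewrite -mt inE => /orP[/eqP->|zt pz]; first by rewrite (negPf npm).
  by apply/hasP; exists z.
case/split_last_has=> t1 [b [t2 [et pb at2]]].
have [a [r er]] : exists a r, t2 ++ m :: rcons t1 b = a :: r.
  by case: (t2) => [|a r]; eexists; eexists.
have perm_er : t2 ++ m :: rcons t1 b = rot (size (m :: rcons t1 b)) (m :: t).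
  rewrite et -cat_rcons -cat_cons rot_size_cat //.
exists a, r; split.
- by rewrite -er perm_er rot_cycle.
- by rewrite -er perm_er rot_uniq.
- by move=> z; rewrite -er perm_er mem_rot mt.
- by case: (t2) er at2 => [[<-]|y r' [<- _] /andP[]].
have -> : last a r = last m (a :: r) by [].
by rewrite -er last_cat /= last_rcons.
Qed.

(* Zajac's proof: a maximal path closes up to a cycle at its end; colour along the cycle
   (or along a Hamiltonian path) so that the last vertex sees one colour twice. *)
Theorem brooks (A : {set V}) : 2 < k ->
  (forall v, v \in A -> #|nbh v :&: A| <= k) ->
  (forall K : {set V}, K \subset A -> clique K -> #|K| <= k) ->
  exists c : V -> 'I_k, coloring A c.
Proof.
move=> k3; have [n] := ubnP #|A|; elim: n A => // n IHn A ltA dA clA.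
have IH (B : {set V}) : B \proper A -> exists c : V -> 'I_k, coloring B c.
  move=> pBA; have sBA := proper_sub pBA; apply: IHn.
  - by apply: leq_trans (proper_card pBA) _; rewrite -ltnS.
  - move=> v /(subsetP sBA)/dA; apply: leq_trans; apply: subset_leq_card.
    exact: setIS.
  - by move=> K /subset_trans-/(_ _ sBA); apply: clA.
have [/existsP[v /andP[vA dv]]|/existsPn reg] :=
  boolP [exists v, (v \in A) && (#|nbh v :&: A| < k)].
  have [c pc] := IH _ (properD1 vA).
  have [|c' pc' _] := @coloring_extend _ (A :\ v) c v pc.
    rewrite card_ord; apply: leq_ltn_trans (leq_imset_card _ _) _.
    apply: leq_ltn_trans dv; apply: subset_leq_card; apply: setIS; exact: subD1set.
  by exists c'; rewrite setD1K in pc'.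
have {}reg v : v \in A -> #|nbh v :&: A| = k.
  by move=> vA; move: (reg v) (dA v vA); rewrite vA /=; clear; lia.
have [->|/set0Pn[v vA]] := eqVneq A set0.
  by exists (fun=> Ordinal (ltnW (ltnW k3))) => x y; rewrite inE.
(* Otherwise [v] and its [k] neighbours would form a clique of size [k + 1]. *)
have [x [z [xN zN xz hxz]]] :
  exists x z, [/\ x \in nbh v :&: A, z \in nbh v :&: A, x != z & ~~ h x z].
  have [/existsP[x /existsP[z /and4P[]]]|none] := boolP [exists x, exists z,
    [&& x \in nbh v :&: A, z \in nbh v :&: A, x != z & ~~ h x z]].
    by exists x, z.
  suff : #|v |: nbh v :&: A| <= k.
    by rewrite cardsU1 reg // !inE h_irr /= add1n ltnn.
  apply: clA; first by rewrite subUset sub1set vA subsetIr.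
  move=> a b /setU1P[->|aN] /setU1P[->|bN]; rewrite ?eqxx //.
  - by move: bN; rewrite !inE => /andP[].
  - by move: aN; rewrite !inE h_sym => /andP[].
  move=> ab; apply: contraNT none => hab; apply/existsP; exists a; apply/existsP.
  by exists b; rewrite aN bN ab.
move: (xN) (zN); rewrite !inE => /andP[hvx xA] /andP[hvz zA].
have vx : v != x by apply: contraTneq hvx => ->; rewrite h_irr.
have vz : v != z by apply: contraTneq hvz => ->; rewrite h_irr.
have [|||s [/= ps us sA endP]] := @maximal_path A x [:: v; z].
- by rewrite /= h_sym hvx hvz.
- by rewrite /= !inE negb_or eq_sym vx xz vz.
- by move=> y; rewrite !inE => /or3P[] /eqP->.
set P := x :: v :: z :: s in sA endP; have {}us : uniq P by [].
set m := last z s in endP.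
have mA : m \in A.
  by apply: sA; rewrite in_cons [m \in v :: _]in_cons (mem_last z s) !orbT.
(* Cut the path at the first neighbour of its end [m]: the part [q] contains all neighbours of [m]
   in [A] and closes up to a cycle. *)
have [p [q [eP hp hmq]]] : exists p q, [/\ P = p ++ q, ~~ has (h m) p &
    h m (head x q)].
  have hP : has (h m) P.
    have : 0 < #|nbh m :&: A| by rewrite reg // (ltnW (ltnW k3)).
    case/card_gt0P=> y; rewrite !inE => /andP[hmy yA]; apply/hasP; exists y => //.
    exact: endP.
  exists (take (find (h m) P) P), (drop (find (h m) P) P); rewrite cat_take_drop.
  split=> //; first by rewrite has_take // ltnn.
  by rewrite -nth0 nth_drop addn0 nth_find.
have qN y : y \in A -> h m y -> y \in q.
  move=> yA hmy; move: (endP y yA hmy); rewrite eP mem_cat => /orP[yp|//].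
  by case/negP: hp; apply/hasP; exists y.
have mq : m = last x q.
  have : last x P = m by [].
  case: (q) eP hmq => [|y r] eP hmq; last by rewrite eP last_cat.
  case/hasP: hp; exists x => //.
  by rewrite cats0 in eP; rewrite -eP inE eqxx.
case: q => [|q0 q] in eP hmq qN mq *.
  have : 0 < #|nbh m :&: A| by rewrite reg // (ltnW (ltnW k3)).
  by case/card_gt0P=> y; rewrite !inE => /andP[hmy yA]; have := qN y yA hmy.
rewrite /= in hmq mq.
have uq : uniq (q0 :: q) by move: us; rewrite eP cat_uniq => /and3P[].
have cq : cycle h (q0 :: q).
  rewrite /= rcons_path -mq hmq andbT.
  have : path h x (v :: z :: s) by [].
  case: (p) eP => [[-> -> //]|y r [-> ->]].
  by rewrite cat_path /= => /and3P[].
have sqA : {subset q0 :: q <= A} by move=> y yq; apply: sA; rewrite eP mem_cat yq orbT.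
pose Q : {set V} := [set y in q0 :: q].
have sQA : Q \subset A by apply/subsetP=> y; rewrite inE => /sqA.
have q0Q : q0 \in Q by rewrite !inE eqxx.
have pAQ : A :\: Q \proper A.
  rewrite properEneq subsetDl andbT; apply/eqP => e.
  by have := sqA q0; rewrite -e !inE eqxx => /(_ isT).
pose out y := [exists u, (u \in A :\: Q) && h y u].
(* Some cycle vertex has a neighbour off the cycle while [m] has none, so there is a cycle edge
   between some [a] without and some [l] with an outer neighbour [u]. Then [a] may take the colour
   of [u]; colouring the cycle from the other side of [a] towards [l] makes [l] see that colour
   twice. *)
have [hasout|noout] := boolP (has out (q0 :: q)).
  have nom : ~~ out m.
    apply/existsPn=> u; rewrite !inE; apply/negP => /andP[/andP[uq' uA] hmu].
    by move: (qN u uA hmu); rewrite inE (negPf uq').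
  have [|a [t [pat uat eat nouta /existsP[u /andP[uAQ hlu]]]]] :=
    cycle_boundary cq uq _ nom hasout.
    by rewrite mq mem_last.
  have [c pc] := IH _ pAQ.
  case: t => [|b t] in pat uat eat hlu *.
    by case/existsP: nouta; exists u; rewrite uAQ.
  move: pat; rewrite /= rcons_path => /andP[hab /andP[pbt hla]].
  have atA y : y \in [:: a, b & t] -> y \in A by rewrite eat => /sqA.
  have eQ y : (y \in Q) = (y \in [:: a, b & t]) by rewrite inE eat.
  have aB : a \notin A :\: Q by rewrite in_setD eQ inE eqxx.
  have ua : u != a by apply: contraNneq aB => <-.
  pose c1 y := if y \in [set a] then c u else c y.
  have pc1 : coloring ((A :\: Q) :|: [set a]) c1.
    apply: (coloring_setU pc (d := fun=> c u)).
      by move=> y y' /set1P-> /set1P->; rewrite h_irr.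
    move=> y y' yB /set1P-> _ hya; case/existsP: nouta; exists y.
    by rewrite yB h_sym.
  have [|||||c2 pc2 e2] := @path_color 'I_k A (card_ord k) dA t b _ _ pc1.
  - exact: pbt.
  - by move: uat => /= /andP[].
  - by move=> y yt; apply: atA; rewrite inE yt orbT.
  - by rewrite subUset subsetDl sub1set atA // inE eqxx.
  - move=> y yt; rewrite in_setU negb_or in_setD eQ in_cons yt orbT in_set1 /=.
    by apply/eqP => ya; move: uat; rewrite cons_uniq -ya yt.
  set B := _ :|: _ in pc2.
  pose l := last b t; rewrite -/l in hlu.
  have lA : l \in A by apply: atA; rewrite inE mem_last orbT.
  have uB : u \in B by rewrite !inE in uAQ *; rewrite uAQ.
  have aB' : a \in B by rewrite !inE eqxx !orbT.
  have [|c3 pc3 _] := @coloring_extend _ B c2 l pc2.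
    rewrite card_ord; apply: leq_trans (dA l lA).
    apply: leq_trans (subset_leq_card (_ : nbh l :&: B \subset _)); last first.
      apply: setIS; rewrite !subUset subsetDl sub1set atA ?inE ?eqxx //=.
      apply/subsetP=> y; rewrite inE => yt; apply: atA.
      by rewrite in_cons (mem_belast yt) orbT.
    apply: (card_imset_pair (x := u) (y := a)) => //.
    - by rewrite inE uB andbT inE.
    - by rewrite inE aB' andbT inE.
    have ea : c2 a = c1 a by apply: e2; rewrite !inE eqxx orbT.
    have eu : c2 u = c1 u by apply: e2; rewrite inE uAQ.
    by rewrite ea eu /c1 !inE eqxx (negPf ua).
  exists c3; apply: coloring_sub pc3; apply/subsetP=> y yA.
  rewrite in_setU1 !in_setU in_setD yA andbT eQ in_cons lastI mem_rcons in_cons -/l.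
  by rewrite !inE; case: (y == l); case: (y == a); case: (y \in belast b t).
(* No edge of [A] leaves the cycle, so the cycle and the rest are coloured independently, unless the
   cycle is all of [A], when the path is Hamiltonian. *)
have {}noout y u : y \in Q -> u \in A :\: Q -> ~~ h y u.
  rewrite inE => yq uAQ; apply: contraNN noout => hyu.
  by apply/hasP; exists y => //; apply/existsP; exists u; rewrite uAQ.
have [eQA|nQA] := eqVneq Q A; last first.
  have [|c pc] := IH Q; first by rewrite properEneq nQA.
  have [d pd] := IH _ pAQ.
  exists (fun y => if y \in A :\: Q then d y else c y).
  apply: (@coloring_sub _ _ (Q :|: (A :\: Q))).
    by apply/subsetP=> y yA; rewrite !inE yA andbT orbN.
  apply: coloring_setU pc pd _.
  by move=> y u yQ uAQ _ hyu; case/negP: (noout y u yQ uAQ).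
have AP y : y \in A -> y \in P by rewrite -eQA inE eP mem_cat => ->; rewrite orbT.
(* As [k > 2], [v] has a third neighbour [w], further along the path. Give [x] and [z] one colour,
   colour forwards from [z] up to just before [w], then backwards from the end of the path to [w].
   Each vertex still has an uncoloured neighbour at its turn, the last ones being [w] for the first
   stretch and [v] for the second; finally [v] sees [x] and [z] in the same colour. *)
have [w wA /and3P[hvw wx wz]] : exists2 w, w \in A & [&& h v w, w != x & w != z].
  have : 0 < #|(nbh v :&: A) :\ x :\ z|.
    have := cardsD1 x (nbh v :&: A); have := cardsD1 z ((nbh v :&: A) :\ x).
    by rewrite reg // xN; move: k3; case: (z \in _); clear; lia.
  case/card_gt0P=> w; rewrite !inE => /and4P[wz wx hvw wA].
  by exists w => //; rewrite hvw wx.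
have ws : w \in s.
  move: (AP w wA); rewrite !inE (negPf wx) (negPf wz) /= => /orP[/eqP e|//].
  by move: hvw; rewrite e h_irr.
have [s1 [s2 es]] : exists s1 s2, s = s1 ++ w :: s2.
  by case/splitPr: ws => s1 s2; exists s1, s2.
move: ps us sA AP; rewrite /P {}es => /and3P[_ _].
rewrite -cat_rcons cat_path last_rcons => /andP[pz pw] us sA AP.
have notin y : y \in rcons s1 w ++ s2 -> [&& y != x, y != v & y != z].
  move: us => /= /and4P[+ + + _] ys; rewrite !inE !negb_or.
  move=> /and3P[_ _ nx] /andP[_ nv] nz.
  by apply/and3P; split; apply: contraTneq ys => ->.
have v0 : v \notin rcons s1 w ++ s2 by apply/negP => /notin/and3P[_ /eqP].
have u12 : uniq (rcons s1 w ++ s2) by move: us => /= /and4P[].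
have [y [t eyt]] : exists y t, rcons s1 w = y :: t.
  by case: (s1) => [|y r]; eexists; eexists.
have bt : belast y t = s1.
  by have := lastI y t; rewrite -eyt => /rcons_inj[].
pose c0 := fun _ : V => Ordinal (ltnW (ltnW k3)).
have pc0 : coloring [set x; z] c0.
  move=> a b /set2P[]-> /set2P[]->; rewrite ?h_irr // ?(h_sym z) => e.
    by rewrite e in hxz.
  by rewrite e in hxz.
have [|||||c1 pc1 e1] := @path_color 'I_k A (card_ord k) dA t y _ _ pc0.
- by move: pz; rewrite eyt => /andP[].
- by rewrite -eyt; move: u12; rewrite cat_uniq => /and3P[].
- by rewrite -eyt => a ar; apply: sA; rewrite !inE mem_cat ar !orbT.
- by rewrite subUset !sub1set xA.
- rewrite -eyt => a ar; have /and3P[ax _ az] : [&& a != x, a != v & a != z].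
    by apply: notin; rewrite mem_cat ar.
  by rewrite !inE negb_or ax.
rewrite bt in pc1; set B1 := _ :|: _ in pc1.
pose l := last v (w :: s2); pose r := rev (belast v (w :: s2)).
have elr : l :: r = rcons (rev (w :: s2)) v.
  by rewrite -rev_cons [v :: _]lastI rev_rcons.
have br : belast l r = rev (w :: s2).
  by have := lastI l r; rewrite {1}elr => /rcons_inj[].
have memlr a : (a \in l :: r) = (a \in v :: w :: s2).
  by rewrite elr -rev_cons mem_rev.
have uvw : uniq (v :: w :: s2).
  rewrite cons_uniq; move: u12 v0; rewrite cat_rcons cat_uniq mem_cat negb_or.
  by move=> /and3P[_ _ ->] /andP[_ ->].
have [|||||c2 pc2 e2] := @path_color 'I_k A (card_ord k) dA r l _ _ pc1.
- rewrite /l /r rev_path (eq_path (e' := h)); last by move=> a b; rewrite h_sym.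
  by rewrite /= hvw.
- by rewrite elr -rev_cons rev_uniq.
- move=> a; rewrite memlr => ar; apply: sA; move: ar; rewrite !inE mem_cat mem_rcons inE.
  by case/or3P=> ->; rewrite ?orbT.
- rewrite !subUset !sub1set xA zA /=; apply/subsetP=> a; rewrite inE => a1.
  by apply: sA; rewrite !inE mem_cat mem_rcons inE a1 !orbT.
- move=> a; rewrite memlr => ar; rewrite !inE; apply/negP.
  move: ar; rewrite in_cons => /orP[/eqP->|aw].
    rewrite (negPf vx) (negPf vz) /= => v1.
    by move: v0; rewrite mem_cat mem_rcons inE v1 orbT.
  have as2 : a \in rcons s1 w ++ s2 by rewrite cat_rcons mem_cat aw orbT.
  have /and3P[/negPf-> _ /negPf->] := notin a as2 => /= a1.
  move: u12; rewrite cat_rcons cat_uniq => /and3P[_ /hasP[]]; exists a => //.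
rewrite br in pc2; set B2 := _ :|: _ in pc2.
have xB : x \in B1 by rewrite !inE eqxx.
have zB : z \in B1 by rewrite !inE eqxx orbT.
have [|c3 pc3 _] := @coloring_extend _ B2 c2 v pc2.
  rewrite card_ord; apply: leq_trans (dA v vA).
  apply: leq_trans (subset_leq_card (_ : nbh v :&: B2 \subset _)); last first.
    apply: setIS; rewrite !subUset !sub1set xA zA /=; apply/andP; split.
      apply/subsetP=> a; rewrite inE => a1.
      by apply: sA; rewrite !inE mem_cat mem_rcons inE a1 !orbT.
    apply/subsetP=> a; rewrite inE mem_rev => a2.
    by apply: sA; rewrite cat_rcons !inE mem_cat a2 !orbT.
  apply: (card_imset_pair (x := x) (y := z)) => //.
  - by rewrite in_setI [x \in nbh v]inE hvx in_setU xB.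
  - by rewrite in_setI [z \in nbh v]inE hvz in_setU zB.
  by rewrite !e2 // !e1 // !inE eqxx ?orbT.
exists c3; apply: coloring_sub pc3; apply/subsetP=> a /AP.
rewrite !inE cat_rcons mem_cat mem_rev inE.
by do !case: (a == _) => //=; case: (a \in s1).
Qed.
End Brooks.
End Coloring.

(** * Optimal partitions and recolouring *)

Lemma pick_avoid2 (C : finType) (A : {set C}) p q :
  2 < #|A| -> exists x, [/\ x \in A, x != p & x != q].
Proof.
move=> A3; have /card_gt0P[x] : 0 < #|A :\ p :\ q|.
  have := cardsD1 p A; have := cardsD1 q (A :\ p); lia.
by rewrite !inE => /and3P[xq xp xA]; exists x.
Qed.

Section Partition.
Variables (V : finType) (h : rel V).
Hypotheses (h_sym : symmetric h) (h_irr : irreflexive h).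

Lemma card_nbh_setU1 (A : {set V}) v x :
  v \notin A -> #|nbh h x :&: (v |: A)| = h x v + #|nbh h x :&: A|.
Proof.
move=> vA; rewrite (cardsD1 v) !inE eqxx andbT; congr (_ + #|pred_of_set _|).
apply/setP=> z; rewrite !inE; have [->|] //= := eqVneq z v.
by rewrite (negPf vA) andbF.
Qed.

Lemma sum_nbh_setU1 (A : {set V}) v : v \notin A ->
  \sum_(x in v |: A) #|nbh h x :&: (v |: A)| =
  \sum_(x in A) #|nbh h x :&: A| + 2 * #|nbh h v :&: A|.
Proof.
move=> vA; rewrite big_setU1 //= card_nbh_setU1 // h_irr add0n.
under eq_bigr => x _ do rewrite card_nbh_setU1 //.
rewrite big_split /=.
suff -> : \sum_(x in A) (h x v : nat) = #|nbh h v :&: A| by lia.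
rewrite -sum1_card big_mkcond [RHS]big_mkcond /=; apply: eq_bigr => x _.
by rewrite !inE h_sym; case: (x \in A); case: (h v x).
Qed.

(* In the minimised potential the weight 3 of a vertex of A lies strictly between 2 and 4: with
   total degree at most 8, a vertex of A with three neighbours in A has five outside. *)
Lemma lovasz_partition (X : {set V}) : exists A : {set V}, [/\ A \subset X,
  forall v, v \in A -> #|nbh h v :&: A| + 2 <= #|nbh h v :&: (X :\: A)| &
  forall v, v \in X :\: A -> #|nbh h v :&: (X :\: A)| <= #|nbh h v :&: A| + 1].
Proof.
(* [S] counts every edge twice, so moving a vertex changes [pot] by twice the difference of its two
   degrees, plus or minus 3. As 3 is odd, minimality rounds to the bounds 2 and 1. *)
pose S (A : {set V}) := \sum_(x in A) #|nbh h x :&: A|.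
pose pot (A : {set V}) := S A + S (X :\: A) + 3 * #|A|.
have [/= A sAX minA] := @arg_minnP _ set0 (fun A : {set V} => A \subset X) pot (sub0set X).
exists A; split=> // v.
- move=> vA; set B := X :\: A; pose A' := A :\ v.
  have vA' : v \notin A' by rewrite !inE eqxx.
  have vB : v \notin B by rewrite !inE vA.
  have eA : v |: A' = A by rewrite setD1K.
  have eB : X :\: A' = v |: B.
    apply/setP=> z; rewrite !inE; have [->|//] := eqVneq z v.
    by rewrite (subsetP sAX).
  have := minA A' (subset_trans (subD1set _ _) sAX).
  have := cardsD1 v A; have := @card_nbh_setU1 A' v v vA'.
  have := sum_nbh_setU1 vB; have := sum_nbh_setU1 vA'.
  rewrite /pot eB -/(S _) -/(S B) -/(S (v |: B)) eA -/(S A') -/(S A) h_irr vA -/A' -/B.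
  lia.
- set B := X :\: A => vB; pose B' := B :\ v; move: (vB); rewrite inE => /andP[vA vX].
  have vB' : v \notin B' by rewrite !inE eqxx.
  have eB : v |: B' = B by rewrite setD1K.
  have eB' : X :\: (v |: A) = B' by apply/setP=> z; rewrite !inE negb_or andbA.
  have sv : v |: A \subset X by rewrite subUset sub1set vX.
  have := minA _ sv.
  have := cardsU1 v A; have := @card_nbh_setU1 B' v v vB'.
  have := sum_nbh_setU1 vB'; have := sum_nbh_setU1 vA.
  rewrite /pot eB' -/(S _) -/(S B) -/(S (v |: A)) eB -/(S B') -/(S A) -/(S B) h_irr vA -/B.
  lia.
Qed.

Definition cliqueb (K : {set V}) :=
  [forall x in K, forall y in K, (x != y) ==> h x y].

Lemma cliqueP K : reflect (clique h K) (cliqueb K).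
Proof.
apply: (iffP forall_inP) => [cK x y xK yK xy|cK x xK].
  by move/forall_inP: (cK x xK) => /(_ y yK); rewrite xy.
by apply/forall_inP=> y yK; apply/implyP; apply: cK.
Qed.

Definition isl (A B : Type) (z : A + B) := if z is inl _ then true else false.

(* The recolouring data at a 4-clique Q of the part V1: moving e to the colours of V2 and
   f, f' to those of V1 frees a colour for e. *)
Definition swappable (V1 V2 Q : {set V}) e := exists l f f' w w', [/\
  [/\ l \in Q, l != e, f \in V2, f' \in V2 & f != f'],
  [/\ h e f, h e f', ~~ h f f', ~~ h f l & ~~ h f' l],
  forall t, h f t || h f' t ->
    [\/ t = w, t = w' | exists2 q, q \in Q & h q t] &
  forall t, t \in V1 -> ~~ h w t && ~~ h w' t].

Definition swap (C : eqType) (a b x : C) :=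
  if x == a then b else if x == b then a else x.

Lemma swap_inj (C : eqType) (a b : C) : injective (swap a b).
Proof.
move=> x y; rewrite /swap.
have [->|xa] := eqVneq x a; have [->|ya] := eqVneq y a => //.
- by have [->|yb] := eqVneq y b => // e; rewrite e eqxx in yb.
- by have [->|xb] := eqVneq x b => // e; rewrite e eqxx in xb.
have [->|xb] := eqVneq x b; have [->|yb] := eqVneq y b => //.
- by move=> e; rewrite e eqxx in ya.
- by move=> e; rewrite e eqxx in xa.
Qed.

(** * Repairing the 4-cliques of the first part *)

Section Recolor.
Variables (V1 V2 : {set V}).
Hypothesis disj12 : [disjoint V1 & V2].
Hypothesis deg1 : forall v, v \in V1 -> #|nbh h v :&: V1| <= 3.
Hypothesis deg2 : forall v, v \in V2 -> #|nbh h v :&: V2| <= 4.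
Hypothesis noK5 : forall K : {set V}, K \subset V2 -> clique h K -> #|K| <= 4.
Hypothesis swapK4 : forall (Q : {set V}) e, Q \subset V1 -> clique h Q -> #|Q| = 4 ->
  e \in Q -> #|nbh h e :&: V2| <= 5 /\ swappable V1 V2 Q e.

(** A member already has its three permitted neighbours inside [Q], so [Q] is a component of the
    graph on [V1]. *)
Lemma K4_component (Q : {set V}) x t : Q \subset V1 -> clique h Q -> #|Q| = 4 ->
  x \in Q -> t \in V1 -> h x t -> t \in Q.
Proof.
move=> sQ cQ Q4 xQ tV hxt.
have sub : Q :\ x \subset nbh h x :&: V1.
  apply/subsetP=> y; rewrite !inE => /andP[yx yQ].
  by rewrite cQ // 1?eq_sym // (subsetP sQ).
have /eqP e : Q :\ x == nbh h x :&: V1.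
  rewrite eqEcard sub (leq_trans (deg1 (subsetP sQ x xQ))) //.
  by have := cardsD1 x Q; rewrite Q4 xQ add1n => -[<-].
by have : t \in Q :\ x; [rewrite e !inE hxt | rewrite inE => /andP[]].
Qed.

Local Notation color := ('I_3 + 'I_4)%type.

(* Invariant while V1 is coloured vertex by vertex: a 4-clique that is not yet complete uses only
   the three colours of V1, and its neighbours in V2 only the four colours of V2. *)
Definition good (D : {set V}) := exists2 c : V -> color, coloring h (V2 :|: D) c &
  forall Q : {set V}, Q \subset V1 -> clique h Q -> #|Q| = 4 -> ~~ (Q \subset D) ->
    (forall q, q \in Q -> q \in D -> isl (c q)) /\
    (forall t q, t \in V2 -> q \in Q -> h q t -> ~~ isl (c t)).

(** [e] takes a colour [inr j] of [V2], while [f] and [f'] both take a colour [inl r] of [V1].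
    Besides the surroundings of [Q], they meet only [w] and [w'], which may carry colours of [V1];
    [r] avoids both. Exchanging [inl r] with the colour of [l] on the rest of [Q] makes [l], which
    conflicts with neither [f] nor [f'], the only member of [Q] coloured [inl r]. *)
Lemma good_step (D Q : {set V}) e : good D -> D \subset V1 -> Q \subset V1 ->
  clique h Q -> #|Q| = 4 -> e \in Q -> e \notin D -> Q :\ e \subset D -> good (e |: D).
Proof.
case=> c pc inv sD sQ cQ Q4 eQ eD QeD.
have V12 t : t \in V1 -> t \notin V2 by move=> tV; rewrite (disjointFr disj12 tV).
have V21 t : t \in V2 -> t \notin V1 by move=> tV; rewrite (disjointFl disj12 tV).
have comp := K4_component sQ cQ Q4.
have nQD : ~~ (Q \subset D) by apply: contraNN eD => /subsetP; apply.
have [invQ invV2] := inv Q sQ cQ Q4 nQD.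
have QD q : q \in Q -> q != e -> q \in D.
  by move=> qQ qe; apply: (subsetP QeD); rewrite !inE qe.
have [de [l [f [f' [w [w' [[lQ le fV fV' ff] [hef hef' nff nfl nfl'] Nf Nw]]]]]]] :=
  swapK4 sQ cQ Q4 eQ.
have QV q : q \in Q -> q \in V1 by apply: (subsetP sQ).
have eV := QV e eQ.
have [r rw rw'] : exists2 r : 'I_3, inl r != c w & inl r != c w'.
  have [|x [/imsetP[r _ ->] xw xw']] :=
    @pick_avoid2 _ [set (inl i : color) | i in 'I_3] (c w) (c w').
    by rewrite card_imset ?card_ord // => i j [].
  by exists r.
(* Without [f] and [f'], at most three of the five neighbours of [e] in [V2] remain against four
   colours. The default [ord0] in [g4] is harmless, since only the number of neighbours is used. *)
have [j jfree] : exists j : 'I_4, forall y, y \in nbh h e :&: V2 -> y != f -> y != f' ->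
    c y != inr j.
  pose g4 z : 'I_4 := if c z is inr i then i else ord0.
  have [|j jN] := @free_color V _ g4 ((nbh h e :&: V2) :\ f :\ f').
    rewrite card_ord; apply: leq_ltn_trans (leq_imset_card _ _) _.
    have := cardsD1 f (nbh h e :&: V2); have := cardsD1 f' ((nbh h e :&: V2) :\ f).
    by rewrite !inE hef hef' fV fV' eq_sym ff /=; move: de; clear; lia.
  exists j => y yN yf yf'; have := jN y; rewrite !in_setD1 yf yf' yN => /(_ isT).
  by apply: contraNneq; rewrite /g4 => ->.
pose c' z := if z == e then inr j else if (z == f) || (z == f') then inl r
  else if z \in Q then swap (c l) (inl r) (c z) else c z.
have c'e : c' e = inr j by rewrite /c' eqxx.
have nef z : z \in V2 -> z != e by apply: contraTneq => ->; apply: V12.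
have c'f z : (z == f) || (z == f') -> c' z = inl r.
  move=> zf; have zV : z \in V2 by case/orP: zf => /eqP->.
  by rewrite /c' (negPf (nef z zV)) zf.
have Qf z : z \in V1 -> (z == f) || (z == f') = false.
  by move=> zV; apply/negbTE; rewrite negb_or; apply/andP; split;
     apply: contraTneq zV => ->; apply: V21.
have c'Q z : z \in Q -> z != e -> c' z = swap (c l) (inl r) (c z).
  by move=> zQ ze; rewrite /c' (negPf ze) Qf ?QV // zQ.
have c'Ql z : z \in Q -> z != e -> isl (c' z).
  move=> zQ ze; rewrite c'Q // /swap; do !case: ifP => _ //.
    by apply: invQ => //; apply: QD.
  by apply: invQ => //; apply: QD.
have c'o z : z \notin Q -> (z == f) || (z == f') = false -> c' z = c z.
  move=> zQ zf; rewrite /c' zf (negPf zQ); case: eqP => // ez.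
  by rewrite ez eQ in zQ.
have neq a b : isl a -> ~~ isl b -> a != b :> color by case: a => // a; case: b.
(* Only edges of the conflict graph with a recoloured end matter, and by symmetry that end may be
   taken first. *)
have key x y : x \in V2 :|: (e |: D) -> y \in V2 :|: (e |: D) -> h x y ->
    x \in Q :|: [set f; f'] -> c' x != c' y.
  have inV z : z \in V2 :|: (e |: D) -> (z \in V2) || (z \in V1).
    by rewrite !inE; case/or3P=> [->//|/eqP->|/(subsetP sD)->]; rewrite ?eV orbT.
  move=> xX yX hxy; rewrite inE => /orP[xQ|xf].
    have [yV|yV] := boolP (y \in V1).
      have yQ := comp x y xQ yV hxy.
      have [ex|xe] := eqVneq x e.
        rewrite ex c'e eq_sym; apply: neq => //; apply: c'Ql => //.
        by apply: contraTneq hxy => ->; rewrite ex h_irr.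
      have [ey|ye] := eqVneq y e; first by rewrite ey c'e; apply: neq => //; apply: c'Ql.
      rewrite !c'Q // (inj_eq (@swap_inj _ _ _)); apply: pc => //.
        by rewrite inE QD ?orbT.
      by rewrite inE QD ?orbT.
    have yV2 : y \in V2 by move: (inV y yX); rewrite (negPf yV) orbF.
    have yQ : y \notin Q by apply: contraNN yV; apply: QV.
    have yinr : ~~ isl (c y) := invV2 y x yV2 xQ hxy.
    have [yf|yf] := boolP ((y == f) || (y == f')).
      rewrite (c'f y) //; have [->|xe] := eqVneq x e; first by rewrite c'e.
      rewrite c'Q //; apply/eqP => es.
      have : c x = c l.
        apply: (@swap_inj _ (c l) (inl r)); rewrite es /swap eqxx //.
      move/eqP; apply/negP; apply: pc; rewrite ?inE ?QD ?orbT //.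
      apply: cQ => //; apply: contraTneq hxy => ->; rewrite h_sym.
      by case/orP: yf => /eqP->.
    rewrite (c'o y) //; last exact: negbTE.
    have [ex|xe] := eqVneq x e; last by apply: neq => //; apply: c'Ql.
    rewrite ex c'e eq_sym; move: yf; rewrite negb_or => /andP[yf yf'].
    by apply: jfree; rewrite // !inE yV2 -ex hxy.
  have {}xf : (x == f) || (x == f') by rewrite !inE in xf.
  rewrite (c'f x) //.
  have hff : h f y || h f' y by case/orP: xf => /eqP <-; rewrite hxy ?orbT.
  have nyl : y != l.
    apply: contraTneq hff => ->; by rewrite negb_or nfl.
  have nyf : (y == f) || (y == f') = false.
    apply/negbTE; apply: contraTN hff => /orP[]/eqP->; rewrite ?h_irr ?orbF ?orFb //.
      by rewrite h_sym.
  have [yV|yV] := boolP (y \in V1); last first.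
    have yV2 : y \in V2 by move: (inV y yX); rewrite (negPf yV) orbF.
    have yQ : y \notin Q by apply: contraNN yV; apply: QV.
    rewrite c'o //; have [->//|->//|[q qQ hqy]] := Nf y hff.
    by apply: neq => //; apply: invV2 hqy.
  have [yQ|yQ] := boolP (y \in Q).
    have [->|ye] := eqVneq y e; first by rewrite c'e.
    rewrite c'Q // eq_sym; apply/eqP => es.
    have : c y = c l by apply: (@swap_inj _ (c l) (inl r)); rewrite es /swap eqxx.
    by move/eqP; apply/negP; apply: pc; rewrite ?inE ?QD ?orbT // cQ.
  rewrite c'o //; have [->//|->//|[q qQ hqy]] := Nf y hff.
  by case/negP: yQ; apply: comp hqy.
exists c'.
  move=> x y xX yX hxy.
  have [xS|xS] := boolP (x \in Q :|: [set f; f']); first exact: key.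
  have [yS|yS] := boolP (y \in Q :|: [set f; f']).
    by rewrite eq_sym; apply: key => //; rewrite h_sym.
  have un z : z \notin Q :|: [set f; f'] -> c' z = c z.
    by rewrite !inE negb_or => /andP[zQ zf]; apply: c'o => //; apply: negbTE.
  have inD z : z \in V2 :|: (e |: D) -> z \notin Q :|: [set f; f'] -> z \in V2 :|: D.
    by rewrite !inE negb_or => /or3P[->//|/eqP->|->]; rewrite ?eQ ?orbT.
  by rewrite !un //; apply: pc => //; apply: inD.
move=> Q2 sQ2 cQ2 Q24 nQ2.
have nQ2D : ~~ (Q2 \subset D).
  by apply: contraNN nQ2 => /subset_trans; apply; apply: subsetUr.
have [inv1 inv2] := inv Q2 sQ2 cQ2 Q24 nQ2D.
have dQ q : q \in Q2 -> q \notin Q.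
  move=> qQ2; apply: contraNN nQ2 => qQ; apply/subsetP=> z zQ2.
  have zQ : z \in Q.
    have [->//|zq] := eqVneq z q.
    by apply: (comp q z qQ (subsetP sQ2 z zQ2)); apply: cQ2; rewrite // eq_sym.
  by rewrite inE in_set1; case: eqVneq => //= ze; apply: QD.
have other q : q \in Q2 -> exists2 q', q' \in V1 & h q q'.
  move=> qQ2; have : 0 < #|Q2 :\ q| by have := cardsD1 q Q2; rewrite Q24 qQ2; clear; lia.
  case/card_gt0P=> q'; rewrite !inE => /andP[qq' q'Q2]; exists q'.
    exact: (subsetP sQ2).
  by apply: cQ2; rewrite // eq_sym.
split.
  move=> q qQ2; rewrite in_setU1 => /orP[/eqP qe|qD].
    by move: (dQ q qQ2); rewrite qe eQ.
  rewrite c'o ?dQ //; first exact: inv1.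
  by apply: Qf; apply: (subsetP sQ2).
move=> t q tV qQ2 hqt.
(* Neither [f] nor [f'] touches another incomplete clique [Q2]: a member of [Q2] conflicting with
   them would be [w] or [w'], which have no neighbour in [V1], or would conflict with [Q] and so
   belong to it. *)
have tf : (t == f) || (t == f') = false.
  apply/negbTE/negP => tf.
  have hff : h f q || h f' q by rewrite !(h_sym _ q); case/orP: tf => /eqP<-; rewrite hqt ?orbT.
  have [q' q'V hqq'] := other q qQ2.
  have /andP[nw nw'] := Nw q' q'V.
  have [ew|ew|[p pQ hpq]] := Nf q hff.
  - by rewrite -ew hqq' in nw.
  - by rewrite -ew hqq' in nw'.
  - by case/negP: (dQ q qQ2); apply: (comp p) => //; apply: (subsetP sQ2).
rewrite c'o //; first exact: inv2 hqt.
by apply: contraTN tV => /QV; apply: V12.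
Qed.

(** Brooks' theorem colours [V2] and a maximal subset [A] of [V1] without 4-cliques. By maximality
    each remaining vertex of [V1] completes a 4-clique with three vertices of [A], so adding the
    remaining vertices one at a time is always an instance of [good_step]. *)
Lemma split_coloring : exists c : V -> color, coloring h (V2 :|: V1) c.
Proof.
pose noK4 (A : {set V}) := (A \subset V1) &&
  [forall Q : {set V}, (Q \subset A) && (#|Q| == 4) ==> ~~ cliqueb Q].
have no0 : noK4 set0.
  rewrite /noK4 sub0set; apply/forallP=> Q; apply/implyP=> /andP[].
  by rewrite subset0 => /eqP->; rewrite cards0.
have [/= A /andP[sA nA] maxA] := @arg_maxnP _ set0 noK4 (fun A => #|A|) no0.
have goodA : good A.
  have [|v vA|K sK cK|c1 pc1] := @brooks V h h_sym h_irr 3 A.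
  - by [].
  - apply: leq_trans (deg1 (subsetP sA v vA)); apply: subset_leq_card; exact: setIS.
  - rewrite leqNgt; apply/negP => K4.
    have K4' : #|K| == 4.
      rewrite eqn_leq K4 andbT.
      have [x xK] : exists x, x \in K by apply/card_gt0P; apply: leq_trans K4.
      have := deg1 (subsetP sA x (subsetP sK x xK)); rewrite (cardsD1 x K) xK add1n ltnS.
      apply: leq_trans; apply: subset_leq_card; apply/subsetP=> y; rewrite !inE.
      by case/andP=> yx yK; rewrite (subsetP sA) ?(subsetP sK) // cK // eq_sym.
    by move/forallP: nA => /(_ K); rewrite sK K4' /= => /negP; apply; apply/cliqueP.
  have [|v vA|K sK cK|c2 pc2] := @brooks V h h_sym h_irr 4 V2 => //.
  - exact: deg2.
  - exact: noK5.
  exists (fun z => if z \in V2 then inr (c2 z) else inl (c1 z)).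
    rewrite setUC; apply: (coloring_setU h_sym (c := fun z => inl (c1 z) : color)
      (d := fun z => inr (c2 z) : color)) => //.
  move=> Q sQ cQ Q4 _; split=> [q qQ qA|t q tV _ _]; last by rewrite tV.
  by rewrite (disjointFr disj12) //; apply: (subsetP sA).
have up n : forall D, #|V1 :\: D| = n -> A \subset D -> D \subset V1 -> good D -> good V1.
  elim: n => [|n IHn] D eD sAD sDV gD.
    have -> // : V1 = D; apply/eqP; rewrite eqEsubset sDV andbT -setD_eq0.
    by rewrite -cards_eq0 eD.
  have /card_gt0P[e] : 0 < #|V1 :\: D| by rewrite eD.
  rewrite inE => /andP[eD' eV].
  have eA : e \notin A by apply: contraNN eD'; apply: (subsetP sAD).
  have : ~~ noK4 (e |: A).
    by apply/negP => /maxA; rewrite /geq /= cardsU1 eA add1n ltnn.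
  rewrite negb_and subUset sub1set eV sA /= => /forallPn[Q].
  rewrite negb_imply negbK => /andP[/andP[sQ /eqP Q4] /cliqueP cQ].
  have eQ : e \in Q.
    apply: contraT => eQ; move/forallP: nA => /(_ Q); rewrite Q4 eqxx andbT.
    have -> : Q \subset A.
      apply/subsetP=> z zQ; have := subsetP sQ z zQ; rewrite in_setU1.
      by case/orP=> [/eqP ez|//]; rewrite -ez zQ in eQ.
    by move/cliqueP: cQ => ->.
  apply: (IHn (e |: D)).
  - have := cardsD1 e (V1 :\: D); rewrite eD inE eD' eV add1n => -[->].
    by congr #|pred_of_set _|; apply/setP=> z; rewrite !inE negb_or andbA.
  - exact: subset_trans sAD (subsetUr _ _).
  - by rewrite subUset sub1set eV.
  apply: (@good_step D Q e) => //.
  - by apply: subset_trans sQ _; rewrite subUset sub1set eV.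
  apply/subsetP=> z; rewrite in_setD1 => /andP[ze zQ]; apply: (subsetP sAD).
  by have := subsetP sQ z zQ; rewrite in_setU1 (negPf ze).
by have [c pc _] := up _ A erefl (subxx A) sA goodA; exists c.
Qed.

End Recolor.
End Partition.

(** * The conflict graph *)

(* [{set {set T}}] elaborates with [reverse_coercion] marks that hide equal cardinals from lia *)
Ltac card_lia := clear; cbv beta delta [reverse_coercion]; lia.

Section Conflict.
Variables (T : finType) (g : rel T).
Hypotheses (g_sym : symmetric g) (g_irr : irreflexive g).

Definition edge (a b : T) : {set T} := [set a; b].

Lemma edgeC a b : edge a b = edge b a.
Proof. exact: setUC. Qed.

Lemma edge_eq a b c d : edge a b = edge c d -> (a = c /\ b = d) \/ (a = d /\ b = c).
Proof.
move=> e.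
have : a \in edge c d by rewrite -e set21.
have : b \in edge c d by rewrite -e set22.
have : c \in edge a b by rewrite e set21.
have : d \in edge a b by rewrite e set22.
rewrite !inE => /orP[]/eqP-> /orP[]/eqP ec /orP[]/eqP eb /orP[]/eqP ea; subst; auto.
Qed.

Lemma edge_neq a b c d : a != c -> a != d -> edge a b != edge c d.
Proof. by move=> /eqP ac /eqP ad; apply/eqP => /edge_eq[] []. Qed.

Lemma edge_at a b p : g a b -> p \in edge a b -> exists2 q, g p q & edge a b = edge p q.
Proof.
move=> ab /set2P[]->; first by exists b.
by exists a; rewrite 1?g_sym // edgeC.
Qed.

Definition conf (e f : {set T}) := [exists a, exists x, exists b, exists y,
  [&& g a x, g b y, g a b, x != b & y != a] && ((e == edge a x) && (f == edge b y))].

Lemma confP e f : reflect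
  (exists a x b y, [/\ g a x, g b y, g a b, x != b & y != a] /\ (e = edge a x /\ f = edge b y))
  (conf e f).
Proof.
apply: (iffP existsP) => [[a /existsP[x /existsP[b /existsP[y]]]]|[a [x [b [y [H [-> ->]]]]]]].
  by move=> /andP[/and5P[H1 H2 H3 H4 H5] /andP[/eqP-> /eqP->]]; exists a, x, b, y.
exists a; apply/existsP; exists x; apply/existsP; exists b; apply/existsP; exists y.
by rewrite !eqxx /= andbT; apply/and5P.
Qed.

Lemma confI a x b y :
  g a x -> g b y -> g a b -> x != b -> y != a -> conf (edge a x) (edge b y).
Proof. by move=> *; apply/confP; exists a, x, b, y. Qed.

Lemma conf_sym : symmetric conf.
Proof.
suff imp e f : conf e f -> conf f e by move=> e f; apply/idP/idP; apply: imp.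
by case/confP=> a [x [b [y [[ax bY ab xb ya] [-> ->]]]]]; apply: confI; rewrite // g_sym.
Qed.

Lemma conf_irr : irreflexive conf.
Proof.
move=> e; apply/confP => -[a [x [b [y [[ax bY ab xb ya] [-> /edge_eq]]]]]].
by case=> -[e1 e2]; [move: ab; rewrite e1 g_irr | rewrite e1 eqxx in ya].
Qed.

Lemma conf_edgeP a b f : conf (edge a b) f -> exists p q,
  [/\ g a p, p != b, g p q, q != a & f = edge p q] \/
  [/\ g b p, p != a, g p q, q != b & f = edge p q].
Proof.
case/confP=> c [x [p [q [[cx pq cp xp qc] [/edge_eq e ->]]]]]; exists p, q.
by case: e => -[-> ->]; [left | right]; rewrite ![p == _]eq_sym.
Qed.

Lemma conf_share a b c : conf (edge a b) (edge a c) -> g b c.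
Proof.
case/conf_edgeP=> p [q [[ap pb pq qa /edge_eq]|[bp pa pq qb /edge_eq]]].
  by case=> -[e1 e2]; subst; rewrite ?g_irr // eqxx in ap qa.
by case=> -[e1 e2]; subst; rewrite ?eqxx // in pa.
Qed.

Lemma conf_join a b c d : conf (edge a b) (edge c d) ->
  [\/ g a c, g a d, g b c | g b d].
Proof.
case/conf_edgeP=> p [q [[ap _ _ _ /edge_eq]|[bp _ _ _ /edge_eq]]] [] [e1 e2]; subst.
- by constructor 1.
- by constructor 2.
- by constructor 3.
- by constructor 4.
Qed.

Definition nbrs_but a b : {set T} := [set p | g a p] :\ b.
Definition star a : {set {set T}} := [set edge a q | q in [set p | g a p]].
Definition star_but p a : {set {set T}} := [set edge p q | q in nbrs_but p a].
Definition edges_via a b : {set {set T}} := \bigcup_(p in nbrs_but a b) star_but p a.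

Lemma nbrs_butP a b p : reflect (g a p /\ p != b) (p \in nbrs_but a b).
Proof. by rewrite !inE andbC; apply: andP. Qed.

Lemma star_butP p a f : reflect (exists2 q, g p q /\ q != a & f = edge p q) (f \in star_but p a).
Proof.
apply: (iffP imsetP) => [[q /nbrs_butP qN ->]|[q qN ->]]; exists q => //; exact/nbrs_butP.
Qed.

Lemma edges_viaP a b f : reflect (exists p q, [/\ g a p, p != b, g p q, q != a & f = edge p q])
  (f \in edges_via a b).
Proof.
apply: (iffP bigcupP) => [[p /nbrs_butP[ap pb] /star_butP[q [pq qa] ->]]|
  [p [q [ap pb pq qa ->]]]].
  by exists p, q.
by exists p; [apply/nbrs_butP | apply/star_butP; exists q].
Qed.

Lemma nbh_edge a b : g a b -> nbh conf (edge a b) = edges_via a b :|: edges_via b a.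
Proof.
move=> ab; apply/setP=> f; rewrite !inE; apply/idP/orP.
  by move/conf_edgeP=> [p [q [H|H]]]; [left | right]; apply/edges_viaP; exists p, q.
case=> /edges_viaP[p [q [ap pb pq qa ->]]]; first by apply: confI; rewrite // eq_sym.
by rewrite edgeC; apply: confI; rewrite // 1?g_sym // eq_sym.
Qed.

Hypothesis g_deg : forall v, #|[set u | g v u]| <= 3.

Lemma card_nbrs_but a b : g a b -> #|nbrs_but a b| <= 2.
Proof.
move=> ab; have := g_deg a; rewrite (cardsD1 b [set u | g a u]) inE ab add1n ltnS.
by [].
Qed.

Lemma card_star_but p a : g p a -> #|star_but p a| <= 2.
Proof. by move=> pa; apply: leq_trans (leq_imset_card _ _) (card_nbrs_but pa). Qed.

Lemma card_star a : #|star a| <= 3.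
Proof. exact: leq_trans (leq_imset_card _ _) (g_deg a). Qed.

Lemma card_bigcup_star_but (N : {set T}) a : (forall p, p \in N -> g a p) ->
  #|\bigcup_(p in N) star_but p a| <= 2 * #|N|.
Proof.
move=> aN; rewrite mulnC -sum_nat_const.
apply: leq_trans (_ : \sum_(p in N) #|star_but p a| <= _).
  elim/big_ind2: _ => [|A m B n Am Bn|p _//]; first by rewrite cards0.
  by apply: leq_trans (leq_add Am Bn); rewrite leq_card_setU.
by apply: leq_sum => p /aN ap; apply: card_star_but; rewrite g_sym.
Qed.

Lemma card_edges_via a b : g a b -> #|edges_via a b| <= 4.
Proof.
move=> ab; apply: leq_trans (card_bigcup_star_but _) _; first by move=> p /nbrs_butP[].
by rewrite (leq_mul2l 2 _ 2) card_nbrs_but.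
Qed.

Lemma card_nbh a b : g a b -> #|nbh conf (edge a b)| <= 8.
Proof.
move=> ab; rewrite nbh_edge //; apply: leq_trans (leq_card_setU _ _) _.
by apply: (@leq_add _ _ 4 4); apply: card_edges_via; rewrite // g_sym.
Qed.

(* What conflict degree 8 says about one end a of an edge ab: no 3- or 4-cycle through ab and no
   triangle at a. *)
Record rigid a b : Prop := Rigid {
  rigid_pair : exists y z, [/\ g a y, g a z, y != b, z != b & y != z] /\
    forall p, g a p -> p != b -> p = y \/ p = z;
  rigid_same : forall p q, g a p -> p != b -> g a q -> q != b -> ~~ g p q;
  rigid_cross : forall p q, g a p -> p != b -> g b q -> q != a -> (p != q) && ~~ g p q;
  rigid_next : forall p, g a p -> p != b -> exists2 r, g p r & r != a }.

Lemma rigid_two a x b d p : rigid a x -> g a b -> g a d -> b != x -> d != x -> b != d ->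
  g a p -> p != x -> p = b \/ p = d.
Proof.
case=> -[y [z [_ H]]] _ _ _ ab ad bx dx bd ap px.
move: bd; case: (H p ap px) => ->; case: (H b ab bx) => ->; case: (H d ad dx) => ->;
  by rewrite ?eqxx //; auto.
Qed.

(** At most 2 * 2 * 2 conflicts can be reached from [ab]: two ends, two steps from each end, two
    continuations. With eight conflicts all choices exist and no edge is reached twice. A triangle
    or 4-cycle forbidden by [rigid] would have an edge reached in two ways. *)
Lemma rigid_of_card a b : g a b -> 8 <= #|nbh conf (edge a b)| -> rigid a b.
Proof.
move=> ab; rewrite nbh_edge // => c8.
have ba : g b a by rewrite g_sym.
have [la lb] := (card_edges_via ab, card_edges_via ba).
have cU := cardsUI (edges_via a b) (edges_via b a).
have Da : #|edges_via a b| = 4 by move: c8 la lb cU; card_lia.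
have /cards0_eq dab : #|edges_via a b :&: edges_via b a| = 0 by move: c8 la lb cU; card_lia.
have N2 : #|nbrs_but a b| == 2.
  have : #|edges_via a b| <= 2 * #|nbrs_but a b| by apply: card_bigcup_star_but => p /nbrs_butP[].
  by rewrite Da eqn_leq card_nbrs_but //=; card_lia.
have [y [z [yz Nyz]]] := cards2P _ N2.
have yN : y \in nbrs_but a b by rewrite Nyz set21.
have zN : z \in nbrs_but a b by rewrite Nyz set22.
move: (yN) (zN) => /nbrs_butP[ay yb] /nbrs_butP[az zb].
have eD : edges_via a b = star_but y a :|: star_but z a.
  rewrite /edges_via Nyz big_setU1 ?big_set1 //=; by rewrite inE.
have [ya za] : g y a /\ g z a by rewrite !(g_sym _ a).
have [ly lz] := (card_star_but ya, card_star_but za).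
have cS := cardsUI (star_but y a) (star_but z a); rewrite -eD Da in cS.
have /cards0_eq dS : #|star_but y a :&: star_but z a| = 0 by move: ly lz cS; card_lia.
have Sy : #|star_but y a| = 2 by move: ly lz cS; card_lia.
have Sz : #|star_but z a| = 2 by move: ly lz cS; card_lia.
have Nin p : g a p -> p != b -> p = y \/ p = z.
  by move=> ap pb; apply/set2P; rewrite -Nyz; apply/nbrs_butP.
have noyz : ~~ g y z.
  apply/negP => gyz.
  have : edge y z \in star_but y a :&: star_but z a.
    rewrite inE; apply/andP; split; apply/star_butP.
      by exists z => //; split=> //; apply: contraTneq za => ->; rewrite g_irr.
    exists y; last exact: edgeC.
    by rewrite g_sym gyz; split=> //; apply: contraTneq ya => ->; rewrite g_irr.
  by rewrite dS inE.
have next p : g a p -> p != b -> 1 < #|nbrs_but p a|.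
  move=> ap pb; apply: leq_trans (leq_imset_card (edge p) _).
  by case: (Nin p ap pb) => ->; rewrite -/(star_but _ _) ?Sy ?Sz.
split.
- by exists y, z.
- move=> p q ap pb aq qb; case: (Nin p ap pb) => ->; case: (Nin q aq qb) => ->;
    by rewrite ?g_irr // g_sym.
- move=> p q ap pb bq qa; apply/andP; split.
    apply/eqP => e; subst q.
    have [r [rp ra rb]] : exists r, [/\ g p r, r != a & r != b].
      have : 0 < #|nbrs_but p a :\ b|.
        by have := cardsD1 b (nbrs_but p a); have := next p ap pb; case: (b \in _); card_lia.
      by case/card_gt0P=> r; rewrite in_setD1 => /andP[rb /nbrs_butP[]]; exists r.
    have : edge p r \in edges_via a b :&: edges_via b a.
      by rewrite inE; apply/andP; split; apply/edges_viaP; exists p, r.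
    by rewrite dab inE.
  apply/negP => pq.
  have : edge p q \in edges_via a b :&: edges_via b a.
    rewrite inE; apply/andP; split; apply/edges_viaP; first by exists p, q.
    by exists q, p; split=> //; rewrite 1?g_sym // edgeC.
  by rewrite dab inE.
- move=> p ap pb; have /card_gt0P[r /nbrs_butP[pr ra]] := ltnW (next p ap pb).
  by exists r.
Qed.

End Conflict.

(** * Cliques in an optimal partition *)

Section K4.
Variables (T : finType) (g : rel T).
Hypotheses (g_sym : symmetric g) (g_irr : irreflexive g).
Hypothesis g_deg : forall v, #|[set u | g v u]| <= 3.
Variables (X V1 : {set {set T}}).
Local Notation V2 := (X :\: V1).
Hypothesis X_edge : forall m, m \in X -> exists a b, g a b /\ m = edge a b.
Hypothesis X_tri : forall u v w, g u v -> g v w -> g u w -> edge u v \notin X.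
Hypothesis V1X : V1 \subset X.
Local Notation N := (nbh (conf g)).
Hypothesis opt1 : forall m, m \in V1 -> #|N m :&: V1| + 2 <= #|N m :&: V2|.
Hypothesis opt2 : forall m, m \in V2 -> #|N m :&: V2| <= #|N m :&: V1| + 1.

Lemma card_nbh_X m : #|N m :&: X| = #|N m :&: V1| + #|N m :&: V2|.
Proof.
rewrite -(cardsID V1) -setIA (setIidPr V1X); congr (_ + #|pred_of_set _|).
by apply/setP=> z; rewrite !inE; case: (z \in V1); rewrite ?andbF.
Qed.

Lemma card_nbh_split m : m \in X -> #|N m :&: V1| + #|N m :&: V2| <= 8.
Proof.
case/X_edge=> a [b [ab ->]]; rewrite -card_nbh_X.
by apply: leq_trans (card_nbh g_sym g_deg ab); apply: subset_leq_card; apply: subsetIl.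
Qed.

Lemma deg_V1 m : m \in V1 -> #|N m :&: V1| <= 3.
Proof.
by move=> mV; move: (opt1 mV) (card_nbh_split (subsetP V1X m mV)); card_lia.
Qed.

Lemma deg_V2 m : m \in V2 -> #|N m :&: V2| <= 4.
Proof.
move=> mV; have mX : m \in X by move: mV; rewrite inE => /andP[].
by move: (opt2 mV) (card_nbh_split mX); card_lia.
Qed.

Lemma conf_vertex a b c d p : g a b -> g c d -> edge a b \in X ->
  conf g (edge a b) (edge c d) -> p \in edge a b -> p \in edge c d -> False.
Proof.
move=> ab cd abX h pab pcd.
have [q pq e] := edge_at g_sym ab pab; have [r pr e'] := edge_at g_sym cd pcd.
rewrite e e' in abX h; have qr := conf_share g_irr h.
by have /negP[] := X_tri pq qr pr.
Qed.

Ltac edge_side := first [by apply: edge_neq; side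
  | by rewrite [X in X != _]edgeC; apply: edge_neq; side
  | by rewrite eq_sym; apply: edge_neq; side].
Ltac split_ands := repeat match goal with H : is_true (_ && _) |- _ => case/andP: H => ? ? end.

Definition covered (K : {set {set T}}) p := exists2 p', g p p' & edge p p' \in K.

(** * 4-cliques in [V1] *)

Section Clique.
Variable Q : {set {set T}}.
Hypotheses (QV1 : Q \subset V1) (cQ : clique (conf g) Q) (Q4 : #|Q| = 4).

Lemma Q_X m : m \in Q -> m \in X.
Proof. by move=> mQ; apply: (subsetP V1X); apply: (subsetP QV1). Qed.

Lemma Q_V1 m t : m \in Q -> conf g m t -> t \in V1 -> t \in Q.
Proof. by move=> mQ h tV; apply: (K4_component (V1 := V1)) h => //; apply: deg_V1. Qed.

Lemma card_Q_nbh m : m \in Q -> 3 <= #|N m :&: V1|.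
Proof.
move=> mQ; have := cardsD1 m Q; rewrite Q4 mQ => -[->].
apply: subset_leq_card; apply/subsetP=> y; rewrite !inE => /andP[ym yQ].
by rewrite (subsetP QV1) // andbT cQ // eq_sym.
Qed.

(** Three clique neighbours and [opt1] give at least five neighbours in [V2], and the total is at
    most 8. Equality also shows, in [Q_nbh_X], that every conflict of a clique edge lies in [X]. *)
Lemma card_Q_V2 m : m \in Q -> #|N m :&: V2| = 5.
Proof.
move=> mQ; move: (card_Q_nbh mQ) (opt1 (subsetP QV1 m mQ)) (card_nbh_split (Q_X mQ)).
by card_lia.
Qed.

Lemma Q_nbh_X m t : m \in Q -> conf g m t -> t \in X.
Proof.
move=> mQ h.
have [a [b [ab em]]] := X_edge (Q_X mQ).
have /eqP e : N m :&: X == N m.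
  rewrite eqEcard subsetIl {1}em (leq_trans (card_nbh g_sym g_deg ab)) //.
  by rewrite card_nbh_X; move: (card_Q_nbh mQ) (card_Q_V2 mQ); card_lia.
by have : t \in N m; [rewrite inE | rewrite -e inE => /andP[]].
Qed.

Lemma Q_V2 m t : m \in Q -> conf g m t -> t \notin Q -> t \in V2.
Proof.
move=> mQ h tQ; rewrite inE (Q_nbh_X mQ h) andbT.
by apply: contraNN tQ; apply: Q_V1 h.
Qed.

Lemma Q_rigid a b : g a b -> edge a b \in Q -> rigid g a b.
Proof.
move=> ab mQ; apply: rigid_of_card => //.
apply: leq_trans (_ : #|N (edge a b) :&: V1| + #|N (edge a b) :&: V2| <= _).
  by move: (card_Q_nbh mQ) (card_Q_V2 mQ); card_lia.
by rewrite -card_nbh_X; apply: subset_leq_card; apply: subsetIl.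
Qed.

Lemma Q_disj a b c d p : g a b -> g c d -> edge a b \in Q -> edge c d \in Q ->
  p \in edge a b -> p \in edge c d -> edge a b = edge c d.
Proof.
move=> ab cd abQ cdQ pab pcd; apply/eqP; apply: contraT => ne.
by case: (conf_vertex ab cd (Q_X abQ) (cQ abQ cdQ ne) pab pcd).
Qed.

Lemma Q_partner a b c : g a b -> g a c -> edge a b \in Q -> edge a c \in Q -> b = c.
Proof.
move=> ab ac abQ acQ; have := Q_disj ab ac abQ acQ (set21 _ _) (set21 _ _).
by case/edge_eq=> -[e1 e2] //; rewrite e2.
Qed.

(* The clique edges aa', bb', cc', dd' hang off the 4-cycle abcd, and a'c', b'd' are edges. *)
Record square (a a' b b' c c' d d' : T) : Prop := Square {
  sq_member : [/\ g a a', g b b', g c c' & g d d'];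
  sq_memberQ : [/\ edge a a' \in Q, edge b b' \in Q, edge c c' \in Q & edge d d' \in Q];
  sq_cycle : [/\ g a b, g b c, g c d & g d a];
  sq_chord : g a' c' /\ g b' d';
  sq_uniq : uniq [:: a; a'; b; b'; c; c'; d; d'] }.

Lemma square_rot a a' b b' c c' d d' :
  square a a' b b' c c' d d' -> square b b' c c' d d' a a'.
Proof.
case=> -[? ? ? ?] [? ? ? ?] [? ? ? ?] [? ?] U; split=> //; first by split; side.
by rewrite -(rot_uniq 2) in U.
Qed.

Lemma square_refl a a' b b' c c' d d' :
  square a a' b b' c c' d d' -> square a a' d d' c c' b b'.
Proof.
case=> -[? ? ? ?] [? ? ? ?] [? ? ? ?] [? ?] U; split=> //; try by split; side.
move: U; rewrite /= !inE !negb_or => U; split_ands.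
by do !(apply/andP; split; try side).
Qed.

Lemma Q_vertex a a' b b' c c' d d' p q :
  edge a a' \in Q -> edge b b' \in Q -> edge c c' \in Q -> edge d d' \in Q ->
  uniq [:: a; a'; b; b'; c; c'; d; d'] -> edge p q \in Q ->
  p \in [:: a; a'; b; b'; c; c'; d; d'].
Proof.
move=> aQ bQ cQ' dQ U.
move: U; rewrite /= !inE !negb_or => U; split_ands.
pose s := [:: edge a a'; edge b b'; edge c c'; edge d d'].
have us : uniq s by rewrite /= !inE !negb_or !edge_neq.
have /eqP <- : [set z in s] == Q.
  rewrite eqEcard Q4 cardsE (card_uniqP us) leqnn andbT; apply/subsetP=> z.
  by rewrite !inE => /or4P[]/eqP->.
by rewrite !inE => /or4P[] /eqP /edge_eq[] [-> _]; rewrite eqxx ?orbT.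
Qed.

(** An edge reached from the chord [a'c'] through [a'] conflicts with a clique edge without being
    one, hence lies in [V2]. If it starts at [a], the witness is the clique edge at [b] or [d];
    otherwise it is [aa'] itself. *)
Lemma square_chord_half a a' b b' c c' d d' p q : square a a' b b' c c' d d' ->
  g a' p -> p != c' -> g p q -> q != a' -> edge p q \notin V1.
Proof.
move=> sq; case: (sq) => -[aa bb cc dd] [aQ bQ cQ' dQ] [ab bc cd da] [ac bd] U0.
move: (U0); rewrite /= !inE !negb_or => U; split_ands.
move=> ap pc pq qa.
have R := Q_rigid aa aQ.
suff [[m mQ h] nQ] : (exists2 m, m \in Q & conf g m (edge p q)) /\ edge p q \notin Q.
  by have := Q_V2 mQ h nQ; rewrite inE => /andP[].
have [pa|pa] := eqVneq p a.
  rewrite pa in pq *; split.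
    have [||||||->|->] := @rigid_two _ _ _ _ b d q R ab => //; try by side.
      by exists (edge d d') => //; apply: confI; side.
    by exists (edge b b') => //; apply: confI; side.
  by apply/negP => /(Q_partner aa pq aQ) e; rewrite e eqxx in qa.
split.
  by exists (edge a' a); [rewrite edgeC | apply: confI; side].
apply/negP => /(Q_vertex aQ bQ cQ' dQ U0).
have X1 x : g a x -> x != a' -> p != x /\ ~~ g x p.
  by move=> ax xa; have := rigid_cross R ax xa ap pa; rewrite eq_sym => /andP[].
have [||pb nb] := X1 b; try by side.
have [||pd nd] := X1 d; try by side.
rewrite !inE => /orP[|/orP[|/orP[|/orP[|/orP[|/orP[|/orP[]]]]]]] /eqP e;
  move: pa pb pd nb nd pc ap; rewrite e ?eqxx ?g_irr //.
- by rewrite bb.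
- by rewrite bc.
- by rewrite dd.
Qed.

Lemma square_chord a a' b b' c c' d d' t : square a a' b b' c c' d d' ->
  conf g (edge a' c') t -> t \notin V1.
Proof.
move=> sq /conf_edgeP[p [q [[ap pc pq qa ->]|[cp pa pq qc ->]]]].
  exact: (square_chord_half sq).
exact: (square_chord_half (square_rot (square_rot sq))).
Qed.

Lemma square_side a a' b b' c c' d d' t : square a a' b b' c c' d d' ->
  conf g (edge b c) t ->
  [\/ t = edge a' c', t = edge b' d' | exists2 m, m \in Q & conf g m t].
Proof.
move=> sq; case: (sq) => -[aa bb cc dd] [aQ bQ cQ' dQ] [ab bc cd da] [ac bd] U.
move: U; rewrite /= !inE !negb_or => U; split_ands.
have Rb := Q_rigid bb bQ; have Rc := Q_rigid cc cQ'.
case/conf_edgeP=> p [q [[bp pc pq qb ->]|[cp pb pq qc ->]]].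
  have [pb'|pb'] := eqVneq p b'.
    rewrite pb' in pq *; have [->|qd] := eqVneq q d'; first by constructor 2.
    by constructor 3; exists (edge d' d); [rewrite edgeC | apply: confI; side].
  have [|||||||pa|pc'] := @rigid_two _ _ _ _ a c p Rb; try by side.
    rewrite pa in pq *.
    by constructor 3; exists (edge b b') => //; apply: confI; side.
  by rewrite pc' eqxx in pc.
have [pc'|pc'] := eqVneq p c'.
  rewrite pc' in pq *; have [->|qa] := eqVneq q a'; first by constructor 1; rewrite edgeC.
  by constructor 3; exists (edge a' a); [rewrite edgeC | apply: confI; side].
have [|||||||pb'|pd] := @rigid_two _ _ _ _ b d p Rc; try by side.
  by rewrite pb' eqxx in pb.
rewrite pd in pq *.
by constructor 3; exists (edge c c') => //; apply: confI; side.
Qed.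

(** The edges exchanged against [aa'] are the sides [bc] and [dc] at the opposite corner, with [cc']
    as [l] and the two chords as [w] and [w']. The sides and [cc'] share the vertex [c], so a
    conflict among [bc], [dc] and [cc'] that involves a side would need a triangle, which rigidity
    forbids. *)
Lemma square_swappable a a' b b' c c' d d' : square a a' b b' c c' d d' ->
  swappable (conf g) V1 V2 Q (edge a a').
Proof.
move=> sq; case: (sq) => -[aa bb cc dd] [aQ bQ cQ' dQ] [ab bc cd da] [ac bd] U.
move: U; rewrite /= !inE !negb_or => U; split_ands.
have sq' := square_refl sq.
have Ra := Q_rigid aa aQ; have Rc := Q_rigid cc cQ'.
have hb : conf g (edge a a') (edge b c) by apply: confI; side.
have hd : conf g (edge a a') (edge d c) by apply: confI; side.
have nb : edge b c \notin Q.
  by apply/negP => /(Q_partner bb bc bQ)/eqP; apply/negP; side.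
have dc : g d c by side.
have nd : edge d c \notin Q.
  by apply/negP => /(Q_partner dd dc dQ)/eqP; apply/negP; side.
exists (edge c c'), (edge b c), (edge d c), (edge a' c'), (edge b' d'); split.
- split=> //.
  + by apply: edge_neq; side.
  + exact: Q_V2 hb nb.
  + exact: Q_V2 hd nd.
  + by apply: edge_neq; side.
- split=> //.
  + rewrite ![edge _ c]edgeC; apply/negP => /(conf_share g_irr); apply/negP.
    by apply: (rigid_same Ra); side.
  + rewrite edgeC; apply/negP => /(conf_share g_irr) bc'.
    have : (b != b) && ~~ g b b by apply: (rigid_cross Rc); side.
    by rewrite eqxx.
  + rewrite edgeC; apply/negP => /(conf_share g_irr) dc'.
    have : (d != d) && ~~ g d d by apply: (rigid_cross Rc); side.
    by rewrite eqxx.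
- move=> t /orP[/(square_side sq)|/(square_side sq')] //.
  by rewrite (edgeC d').
- move=> t tV; apply/andP; split.
    by apply: contraTN tV; apply: (square_chord sq).
  by apply: contraTN tV; apply: (square_chord (square_rot sq)).
Qed.

(* The edge sv would have five neighbours in V2. *)
Lemma twisted_false u v y y' z z' s s' x :
  g u v -> g y y' -> g z z' -> g s s' ->
  edge u v \in Q -> edge y y' \in Q -> edge z z' \in Q -> edge s s' \in Q ->
  uniq [:: u; v; y; y'; z; z'; s; s'; x] ->
  g u y -> g u z -> g v s -> g v x -> g y' z' -> g y s' -> g z' s -> False.
Proof.
move=> uv yy zz ss uvQ yyQ zzQ ssQ U0 uy uz vs vx yz ys zs.
have /andP[U8 xU] : uniq [:: u; v; y; y'; z; z'; s; s'] &&
    (x \notin [:: u; v; y; y'; z; z'; s; s']) by rewrite andbC -rcons_uniq.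
move: U0; rewrite /= !inE !negb_or => U; split_ands.
(* The fifth neighbour of [sv] in [V2] will be [x x1], which exists because [uv] has full conflict
   degree. *)
have [x1 xx1 x1v] : exists2 r, g x r & r != v.
  have vuQ : edge v u \in Q by rewrite edgeC.
  have Rv := Q_rigid (_ : g v u) vuQ.
  by apply: (rigid_next (Rv _)); side.
have sv : g s v by side.
have z's : g z' s by side.
have memV2 a b p q : edge a b \in Q -> edge p q \notin Q -> g a b -> g p q -> g a p ->
    b != p -> q != a -> edge p q \in V2.
  by move=> abQ pqQ ab pq ap bp qa; apply: Q_V2 abQ _ pqQ; apply: confI.
have notQ a b c : edge a b \in Q -> g a b -> g a c -> b != c -> edge a c \notin Q.
  by move=> abQ ab ac; apply: contraNN => /(Q_partner ab ac abQ)->.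
have vuQ : edge v u \in Q by rewrite edgeC.
have z'zQ : edge z' z \in Q by rewrite edgeC.
have y'yQ : edge y' y \in Q by rewrite edgeC.
have s'sQ : edge s' s \in Q by rewrite edgeC.
have svV2 : edge s v \in V2.
  by apply: (memV2 z' z) => //; [apply: (notQ s s')|..]; side.
have := deg_V2 svV2; rewrite leqNgt => /negP; apply; apply/card_geqP.
exists [:: edge u y; edge u z; edge y s'; edge z' y'; edge x x1]; split=> //.
  by rewrite /= !inE !negb_or !andbT; do !(apply/andP; split); edge_side.
have xQ : edge x x1 \notin Q.
  by apply: contraNN xU; apply: Q_vertex.
move=> e eN; rewrite in_setI; apply/andP; split; move: e eN; last first.
  move=> e; rewrite !inE => /orP[|/orP[|/orP[|/orP[]]]] /eqP->; rewrite -in_setD.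
  - by apply: (memV2 z z') => //; [rewrite edgeC; apply: (notQ y y')|..]; side.
  - by apply: (memV2 y y') => //; [rewrite edgeC; apply: (notQ z z')|..]; side.
  - by apply: (memV2 u v) => //; [apply: (notQ y y')|..]; side.
  - by apply: (memV2 s s') => //; [apply: (notQ z' z)|..]; side.
  - by apply: (memV2 v u) => //; side.
move=> e; rewrite [_ \in N _]inE !inE => /orP[|/orP[|/orP[|/orP[]]]] /eqP->.
- by rewrite (edgeC s); apply: confI; side.
- by rewrite (edgeC s); apply: confI; side.
- by rewrite (edgeC y); apply: confI; side.
- by apply: confI; side.
- by rewrite (edgeC s); apply: confI; side.
Qed.

Lemma Q_disj4 a b c d : g a b -> g c d -> edge a b \in Q -> edge c d \in Q ->
  edge a b != edge c d -> [/\ a != c, a != d, b != c & b != d].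
Proof.
move=> ab cd abQ cdQ ne.
have D p := @Q_disj a b c d p ab cd abQ cdQ.
split; apply: contraNneq ne => e; apply/eqP.
- by apply: (D a); rewrite ?set21 // e set21.
- by apply: (D a); rewrite ?set21 // e set22.
- by apply: (D b); rewrite ?set22 // e set21.
- by apply: (D b); rewrite ?set22 // e set22.
Qed.

(** Rigidity leaves only [y'z'] to join the clique edges at [y] and [z], and three ways to join each
    of them to the one at [s]. Of the nine combinations one is a [square], two are the configuration
    of [twisted_false] up to exchanging [y] and [z], and six violate rigidity. *)
Lemma frame_swappable u v y z s x : g u v -> edge u v \in Q ->
  g u y -> g u z -> g v s -> g v x -> y != v -> z != v -> s != u -> x != u ->
  y != z -> s != x -> covered Q y -> covered Q z -> covered Q s ->
  swappable (conf g) V1 V2 Q (edge u v).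
Proof.
move=> uv uvQ uy uz vs vx yv zv su xu yz sx [y' yy yQ] [z' zz zQ] [s' ss sQ].
have vu : g v u by side.
have vuQ : edge v u \in Q by rewrite edgeC.
have Ru := Q_rigid uv uvQ; have Rv := Q_rigid vu vuQ.
have yu : y != u by apply: contraTneq uy => ->; rewrite g_irr.
have zu : z != u by apply: contraTneq uz => ->; rewrite g_irr.
have sv : s != v by apply: contraTneq vs => ->; rewrite g_irr.
have xv : x != v by apply: contraTneq vx => ->; rewrite g_irr.
have uv' : u != v by apply: contraTneq uv => ->; rewrite g_irr.
have yy' : y != y' by apply: contraTneq yy => <-; rewrite g_irr.
have zz' : z != z' by apply: contraTneq zz => <-; rewrite g_irr.
have ss' : s != s' by apply: contraTneq ss => <-; rewrite g_irr.
have gyz : ~~ g y z by apply: (rigid_same Ru).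
have gsx : ~~ g s x by apply: (rigid_same Rv).
have /andP[ys gys] := rigid_cross Ru uy yv vs su.
have /andP[zs gzs] := rigid_cross Ru uz zv vs su.
have /andP[yx gyx] := rigid_cross Ru uy yv vx xu.
have /andP[zx gzx] := rigid_cross Ru uz zv vx xu.
have neq2 p p' q q' : p != q -> ~~ g p q -> g p p' -> edge p p' != edge q q'.
  move=> pq npq pp; apply/eqP => /edge_eq[] [e1 e2]; first by rewrite e1 eqxx in pq.
  by rewrite -e2 pp in npq.
have [yu1 yv1 y'u y'v] := Q_disj4 yy uv yQ uvQ (edge_neq _ yu yv).
have [zu1 zv1 z'u z'v] := Q_disj4 zz uv zQ uvQ (edge_neq _ zu zv).
have [su1 sv1 s'u s'v] := Q_disj4 ss uv sQ uvQ (edge_neq _ su sv).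
have nyz := neq2 y y' z z' yz gyz yy; have nys := neq2 y y' s s' ys gys yy.
have nzs := neq2 z z' s s' zs gzs zz.
have [_ yz1 y'z y'z'] := Q_disj4 yy zz yQ zQ nyz.
have [_ ys1 y's y's'] := Q_disj4 yy ss yQ sQ nys.
have [_ zs1 z's z's'] := Q_disj4 zz ss zQ sQ nzs.
have xy' : x != y' by apply: contraTneq yy => <-.
have xz' : x != z' by apply: contraTneq zz => <-.
have xs' : x != s' by apply: contraTneq ss => <-.
have Ry := Q_rigid yy yQ; have Rz := Q_rigid zz zQ; have Rs := Q_rigid ss sQ.
have y'y : g y' y by side.
have z'z : g z' z by side.
have s's : g s' s by side.
have Ry' : rigid g y' y by apply: Q_rigid; rewrite // edgeC.
have Rz' : rigid g z' z by apply: Q_rigid; rewrite // edgeC.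
have jyz : g y' z'.
  case: (conf_join (cQ yQ zQ nyz)) => // [j|j|j].
  - by rewrite j in gyz.
  - have : (u != y) && ~~ g u y by apply: (rigid_cross Rz); side.
    by rewrite uy andbF.
  - have : (u != z) && ~~ g u z by apply: (rigid_cross Ry); side.
    by rewrite uz andbF.
have jys := conf_join (cQ yQ sQ nys); have jzs := conf_join (cQ zQ sQ nzs).
have s'sQ : edge s' s \in Q by rewrite edgeC.
have cross p p' q r : rigid g p p' -> g p q -> q != p' -> g p' r -> r != p -> g q r -> False.
  by move=> R pq qp pr rp qr; have := rigid_cross R pq qp pr rp; rewrite qr andbF.
have same p p' q r : rigid g p p' -> g p q -> q != p' -> g p r -> r != p' -> g q r -> False.
  by move=> R pq qp pr rp qr; have := rigid_same R pq qp pr rp; rewrite qr.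
case: jys => [j|jy|jy|jy]; first by rewrite j in gys.
- case: jzs => [j|jz|jz|jz]; first by rewrite j in gzs.
  + apply: (@square_swappable u v y y' s' s z z'); split=> //; try by split; side.
    rewrite /= !inE !negb_or !andbT; do !(apply/andP; split); side.
  + exfalso; apply: (@twisted_false u v y y' z z' s s' x) => //; try by side.
    rewrite /= !inE !negb_or !andbT; do !(apply/andP; split); side.
  + by exfalso; apply: (cross y y' s' z' Ry); side.
- case: jzs => [j|jz|jz|jz]; first by rewrite j in gzs.
  + exfalso; apply: (@twisted_false u v z z' y y' s s' x) => //; try by side.
    rewrite /= !inE !negb_or !andbT; do !(apply/andP; split); side.
  + by exfalso; apply: (same s s' y' z' Rs); side.
  + by exfalso; apply: (cross s s' y' z' Rs); side.
- case: jzs => [j|jz|jz|jz]; first by rewrite j in gzs.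
  + by exfalso; apply: (cross z z' s' y' Rz); side.
  + by exfalso; apply: (cross s s' z' y' Rs); side.
  + by exfalso; apply: (same y' y z' s' Ry'); side.
Qed.

(** The other three clique edges are disjoint and each has an end among the four outer neighbours of
    [a] and [b]. Hence three of these four are covered, including both at one end of [ab]. *)
Lemma K4_swappable e : e \in Q -> swappable (conf g) V1 V2 Q e.
Proof.
move=> eQ; have [a [b [ab ee]]] := X_edge (Q_X eQ); subst e.
have ba : g b a by side.
have baQ : edge b a \in Q by rewrite edgeC.
have [a1 [a2 [[aa1 aa2 a1b a2b a12] Na]]] := rigid_pair (Q_rigid ab eQ).
have [b1 [b2 [[bb1 bb2 b1a b2a b12] nbrs_but]]] := rigid_pair (Q_rigid ba baQ).
have meets m : m \in Q :\ edge a b -> exists2 p, p \in m /\ covered Q p &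
    [\/ p = a1, p = a2, p = b1 | p = b2].
  rewrite in_setD1 => /andP[me mQ].
  have /conf_edgeP[p [q H]] : conf g (edge a b) m by apply: cQ; rewrite // eq_sym.
  case: H => -[ap pb pq qa em]; rewrite em in mQ *; exists p; rewrite ?set21.
  - by split=> //; exists q.
  - by case: (Na p ap pb) => ->; [constructor 1 | constructor 2].
  - by split=> //; exists q.
  - by case: (nbrs_but p ap pb) => ->; [constructor 3 | constructor 4].
have sep m m' p : m \in Q :\ edge a b -> m' \in Q :\ edge a b -> m != m' ->
    p \in m -> p \in m' -> False.
  move=> /setD1P[_ mQ] /setD1P[_ m'Q] ne pm pm'.
  have [c [d [cd em]]] := X_edge (Q_X mQ); have [c' [d' [cd' em']]] := X_edge (Q_X m'Q).
  subst m m'; case/eqP: ne; exact: (Q_disj cd cd' mQ m'Q pm pm').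
have /card_gt2P[m1 [m2 [m3 [[m1Q m2Q m3Q] [m12 m23 m31]]]]] : 2 < #|Q :\ edge a b|.
  by have := cardsD1 (edge a b) Q; rewrite Q4 eQ; card_lia.
have [p1 [p1m h1] c1] := meets m1 m1Q.
have [p2 [p2m h2] c2] := meets m2 m2Q.
have [p3 [p3m h3] c3] := meets m3 m3Q.
have p12 : p1 <> p2 by move=> e; apply: (sep m1 m2 p1) => //; rewrite e.
have p23 : p2 <> p3 by move=> e; apply: (sep m2 m3 p2) => //; rewrite e.
have p31 : p3 <> p1 by move=> e; apply: (sep m3 m1 p3) => //; rewrite e.
have [[[ha1 ha2] hb]|[[hb1 hb2] ha]] :
  ((covered Q a1 /\ covered Q a2) /\ (covered Q b1 \/ covered Q b2)) \/
  ((covered Q b1 /\ covered Q b2) /\ (covered Q a1 \/ covered Q a2)).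
  clear - h1 h2 h3 c1 c2 c3 p12 p23 p31.
  case: c1 => e1; case: c2 => e2; case: c3 => e3; subst; try done; tauto.
- case: hb => hb.
    by apply: (@frame_swappable a b a1 a2 b1 b2).
  by apply: (@frame_swappable a b a1 a2 b2 b1); side.
- rewrite edgeC; case: ha => ha.
    by apply: (@frame_swappable b a b1 b2 a1 a2).
  by apply: (@frame_swappable b a b1 b2 a2 a1); side.
Qed.

End Clique.

(** * 5-cliques in [V2] *)

Section Clique5.
Hypothesis X_deg : forall m, m \in X -> 7 <= #|N m :&: X|.
Variable K : {set {set T}}.
Hypotheses (KV2 : K \subset V2) (cK : clique (conf g) K) (K5 : #|K| = 5).

Let K_X m : m \in K -> m \in X.
Proof. by move=> /(subsetP KV2); rewrite inE => /andP[]. Qed.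

Lemma K_disj m m' p : m \in K -> m' \in K -> p \in m -> p \in m' -> m = m'.
Proof.
move=> mK m'K pm pm'; apply/eqP; apply: contraT => ne.
have [c [d [cd em]]] := X_edge (K_X mK); have [c' [d' [cd' em']]] := X_edge (K_X m'K).
subst m m'.
by case: (conf_vertex cd cd' (K_X mK) (cK mK m'K ne) pm pm').
Qed.

Lemma K_partner a b c : edge a b \in K -> edge a c \in K -> b = c.
Proof.
move=> abK acK; have := K_disj abK acK (set21 _ _) (set21 _ _).
by case/edge_eq=> -[e1 e2] //; rewrite e2.
Qed.

(** The other four members of [K] are disjoint and each has an end, chosen by [phi], among the at
    most four outer neighbours of [a] and [b]. So there are exactly four such neighbours and all are
    covered. *)
Lemma K_closed a b : g a b -> edge a b \in K ->
  #|nbrs_but g a b| = 2 /\ (forall p, g a p -> p != b -> covered K p).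
Proof.
move=> ab abK; pose S := nbrs_but g a b :|: nbrs_but g b a.
pose phi (m : {set T}) := odflt a [pick p in S | p \in m].
have phiP m : m \in K :\ edge a b -> phi m \in S /\ phi m \in m.
  rewrite in_setD1 => /andP[me mK]; rewrite /phi.
  case: pickP => [p /andP[]//|none].
  have /conf_edgeP[p [q H]] : conf g (edge a b) m by apply: cK; rewrite // eq_sym.
  have := none p; case: H => -[ap pb pq qa ->]; rewrite set21 andbT.
    by move/negP: (none p) => _; rewrite in_setU (introT (nbrs_butP _ _ _ _) (conj ap pb)).
  by rewrite in_setU (introT (nbrs_butP _ _ _ _) (conj ap pb)) orbT.
have inj : {in K :\ edge a b &, injective phi}.
  move=> m m' mK m'K e; have [_ pm] := phiP m mK; have [_ pm'] := phiP m' m'K.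
  move: mK m'K; rewrite !in_setD1 => /andP[_ mK] /andP[_ m'K].
  by apply: (K_disj mK m'K pm); rewrite e.
have cI : #|phi @: (K :\ edge a b)| = 4.
  by rewrite card_in_imset //; have := cardsD1 (edge a b) K; rewrite K5 abK; card_lia.
have sI : phi @: (K :\ edge a b) \subset S.
  by apply/subsetP=> _ /imsetP[m mK ->]; case: (phiP m mK).
have cS := cardsU (nbrs_but g a b) (nbrs_but g b a); rewrite -/S in cS.
have ba : g b a by rewrite g_sym.
have [la lb] := (card_nbrs_but g_deg ab, card_nbrs_but g_deg ba).
have lS := subset_leq_card sI; rewrite cI in lS.
split; first by move: cS la lb lS; clear; lia.
move=> p ap pb.
have /eqP eS : phi @: (K :\ edge a b) == S.
  by rewrite eqEcard sI cI; move: cS la lb; clear; lia.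
have : p \in S by rewrite in_setU (introT (nbrs_butP _ _ _ _) (conj ap pb)).
rewrite -eS => /imsetP[m mK ep]; have [_] := phiP m mK; rewrite -ep => pm.
move: mK; rewrite in_setD1 => /andP[_ mK].
have [c [d [cd em]]] := X_edge (K_X mK); subst m.
by have [q pq e] := edge_at g_sym cd pm; exists q; rewrite // -e.
Qed.

Lemma K_nbh p p' q : g p p' -> edge p p' \in K -> g p q -> q != p' ->
  exists r, [/\ g p r, r != p', r != q, covered K r &
    forall t, g p t -> t != p' -> t = q \/ t = r].
Proof.
move=> pp pK pq qp; have [N2 cov] := K_closed pp pK.
have qN : q \in nbrs_but g p p' by apply/nbrs_butP.
have [r] : exists r, r \in nbrs_but g p p' :\ q.
  by apply/card_gt0P; have := cardsD1 q (nbrs_but g p p'); rewrite N2 qN; clear; lia.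
rewrite in_setD1 => /andP[rq rN]; move: (rN) => /nbrs_butP[pr rp].
exists r; split=> //; first exact: cov.
move=> t pt tp; apply/set2P.
suff <- : nbrs_but g p p' = [set q; r] by apply/nbrs_butP.
apply/eqP; rewrite eq_sym eqEcard subUset !sub1set qN rN N2.
by rewrite cards2 eq_sym rq.
Qed.

(** If [pq] were outside [K], it would conflict with the clique edge at the third neighbour [r] of
    [p]. That edge would then have five neighbours in [V2], four in [K] and [pq]. *)
Lemma covered_V2 p q : covered K p -> g p q -> edge p q \in V2 -> edge p q \in K.
Proof.
move=> [p' pp pK] pq pqV; have [<-//|qp] := eqVneq p' q.
rewrite eq_sym in qp.
have [r [pr rp rq [r' rr rK] _]] := K_nbh pp pK pq qp.
apply: contraT => nK.
have r'p : r' != p.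
  apply: contraNneq rp => e; rewrite e edgeC in rK.
  by rewrite (K_partner pK rK).
have h : conf g (edge r r') (edge p q) by apply: confI; side.
have := deg_V2 (subsetP KV2 _ rK); rewrite leqNgt => /negP; case.
have -> : 5 = #|edge p q |: (K :\ edge r r')|.
  rewrite cardsU1 in_setD1 (negPf nK) andbF.
  by have := cardsD1 (edge r r') K; rewrite K5 rK; card_lia.
apply: subset_leq_card; apply/subsetP=> m; rewrite in_setU1 => /orP[/eqP->|].
  by rewrite in_setI pqV andbT inE.
rewrite in_setD1 => /andP[mr mK]; rewrite in_setI (subsetP KV2) // andbT inE.
by apply: cK; rewrite // eq_sym.
Qed.

(* The ten ends of the clique edges have all their neighbours among themselves, so an edge n of V1
   at them has at most two neighbours in V2, hence degree at most 5. *)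
Lemma K5_false : False.
Proof.
have /card_gt0P[f fK] : 0 < #|K| by rewrite K5.
have [a [b [ab ef]]] := X_edge (K_X fK); subst f.
(* A clique edge has at least seven neighbours in [X] and at most four in [V2]. *)
have [n nV h] : exists2 n, n \in V1 & conf g (edge a b) n.
  have /card_gt0P[n] : 0 < #|N (edge a b) :&: V1|.
    have := deg_V2 (subsetP KV2 _ fK); have := X_deg (K_X fK); rewrite card_nbh_X.
    by card_lia.
  by rewrite in_setI inE => /andP[h nV]; exists n.
have [p [p' [q [pp pK pq qp en]]]] : exists p p' q,
  [/\ g p p', edge p p' \in K, g p q, q != p' & n = edge p q].
  have V1K m : m \in V1 -> m \notin K.
    by move=> mV; apply/negP => /(subsetP KV2); rewrite inE mV.
  have ba : g b a by side.
  have baK : edge b a \in K by rewrite edgeC.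
  case/conf_edgeP: h => p [q [[ap pb pq _ en]|[bp pa pq _ en]]].
    have [p' pp pK] := (K_closed ab fK).2 p ap pb; exists p, p', q; split=> //.
    by apply: contraNneq (V1K n nV) => e; rewrite en e.
  have [p' pp pK] := (K_closed ba baK).2 p bp pa; exists p, p', q; split=> //.
  by apply: contraNneq (V1K n nV) => e; rewrite en e.
have [q' qq qK] := (K_closed pp pK).2 q pq qp.
have pq' : p != q'.
  by apply: contraNneq qp => e; rewrite -e edgeC in qK; rewrite (K_partner pK qK).
have qp0 : g q p by side.
have [r [pr rp rq [r' rr rK] Np]] := K_nbh pp pK pq qp.
have [s [qs sq sp [s' ss sK] Nq]] := K_nbh qq qK qp0 pq'.
have half x x' y z z' t u : g x x' -> edge x x' \in K -> edge z z' \in K ->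
    (forall t, g x t -> t != x' -> t = y \/ t = z) -> covered K z ->
    g x t -> t != y -> g t u -> u != x -> edge t u \in V2 -> edge t u = edge z z'.
  move=> xx xK zK Nx cz xt ty tu ux tV.
  have [tx|tx] := eqVneq t x'.
    have tc : covered K t by exists x; rewrite ?tx 1?g_sym // edgeC.
    have tK := covered_V2 tc tu tV; rewrite tx in tK.
    rewrite edgeC in xK; by rewrite (K_partner tK xK) eqxx in ux.
  case: (Nx t xt tx) => et; first by rewrite et eqxx in ty.
  by subst t; have tK := covered_V2 cz tu tV; rewrite (K_partner tK zK).
have sub : N n :&: V2 \subset [set edge r r'; edge s s'].
  apply/subsetP=> m; rewrite in_setI inE en => /andP[hm mV].
  case/conf_edgeP: hm mV => t [u [[pt tq tu up ->]|[qt tp tu uq ->]]] mV; apply/set2P.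
    left; apply: (half p p' q r r') => //; by exists r'.
  right; apply: (half q q' p s s') => //; by exists s'.
have nX := subsetP V1X n nV.
have := X_deg nX; rewrite card_nbh_X.
have := deg_V1 nV; have := subset_leq_card sub; rewrite cards2.
by case: (_ != _); card_lia.
Qed.

End Clique5.
End K4.

(** * Triangles *)

Section Prism.
Variable C : finType.
Implicit Types A B : {set C}.

Definition prism_choice A1 A2 A3 B1 B2 B3 := exists a1 a2 a3 b1 b2 b3 : C,
  [/\ [/\ a1 \in A1, a2 \in A2 & a3 \in A3], [/\ b1 \in B1, b2 \in B2 & b3 \in B3],
      [/\ a1 != a2, a1 != a3 & a2 != a3], [/\ b1 != b2, b1 != b3 & b2 != b3] &
      [/\ a1 != b1, a2 != b2 & a3 != b3]].

(** In [prism_choice] the lists [A1], [A2], [A3] and [B1], [B2], [B3] belong to the two triangles of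
    the prism, and the rungs join equal indices. This lemma and the next are symmetries of the
    prism. *)
Lemma prism_swap A1 A2 A3 B1 B2 B3 :
  prism_choice A1 A2 A3 B1 B2 B3 -> prism_choice B1 B2 B3 A1 A2 A3.
Proof.
move=> [a1 [a2 [a3 [b1 [b2 [b3 [H1 H2 H3 H4 [? ? ?]]]]]]]].
by exists b1, b2, b3, a1, a2, a3; split=> //; split; rewrite eq_sym.
Qed.

Lemma prism_rot A1 A2 A3 B1 B2 B3 :
  prism_choice A1 A2 A3 B1 B2 B3 -> prism_choice A2 A3 A1 B2 B3 B1.
Proof.
move=> [a1 [a2 [a3 [b1 [b2 [b3 [[? ? ?] [? ? ?] [? ? ?] [? ? ?] [? ? ?]]]]]]]].
by exists a2, a3, a1, b2, b3, b1; split=> //; split=> //; rewrite eq_sym.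
Qed.

(** A colour for [a1] outside [B1] cannot hurt [b1]. In the order a1, a2, a3, b2, b3, b1 each vertex
    then has at most two forbidden colours. *)
Lemma prism_diff_rung A1 A2 A3 B1 B2 B3 :
  2 < #|A2| -> 2 < #|A3| -> 2 < #|B1| -> 2 < #|B2| -> 2 < #|B3| ->
  ~~ (A1 \subset B1) -> prism_choice A1 A2 A3 B1 B2 B3.
Proof.
move=> cA2 cA3 cB1 cB2 cB3 /subsetPn[a1 a1A a1B].
have [a2 [a2A a21 _]] := pick_avoid2 a1 a1 cA2.
have [a3 [a3A a31 a32]] := pick_avoid2 a1 a2 cA3.
have [b2 [b2B b2a _]] := pick_avoid2 a2 a2 cB2.
have [b3 [b3B b3a b32]] := pick_avoid2 a3 b2 cB3.
have [b1 [b1B b12 b13]] := pick_avoid2 b2 b3 cB1.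
exists a1, a2, a3, b1, b2, b3; split=> //; split=> //; rewrite 1?eq_sym //.
by apply: contraNneq a1B => <-.
Qed.

(** The same idea along a triangle edge: [a1] avoids [A2] and [a2] comes last, in the order a1, b1,
    a3, b3, b2, a2. *)
Lemma prism_diff_triangle A1 A2 A3 :
  2 < #|A1| -> 2 < #|A2| -> 2 < #|A3| ->
  ~~ (A1 \subset A2) -> prism_choice A1 A2 A3 A1 A2 A3.
Proof.
move=> cA1 cA2 cA3 /subsetPn[a1 a1A a1A2].
have [b1 [b1A b1a _]] := pick_avoid2 a1 a1 cA1.
have [a3 [a3A a31 _]] := pick_avoid2 a1 a1 cA3.
have [b3 [b3A b31 b3a]] := pick_avoid2 b1 a3 cA3.
have [b2 [b2A b21 b23]] := pick_avoid2 b1 b3 cA2.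
have [a2 [a2A a23 a2b]] := pick_avoid2 a3 b2 cA2.
exists a1, a2, a3, b1, b2, b3; split=> //; split=> //; rewrite 1?eq_sym //.
by apply: contraNneq a1A2 => <-.
Qed.

(* The prism is 3-choosable: two adjacent vertices with distinct lists give a greedy
   order, and equal lists are coloured by a cyclic shift. *)
Lemma prism_choosable A1 A2 A3 B1 B2 B3 :
  2 < #|A1| -> 2 < #|A2| -> 2 < #|A3| -> 2 < #|B1| -> 2 < #|B2| -> 2 < #|B3| ->
  prism_choice A1 A2 A3 B1 B2 B3.
Proof.
move=> cA1 cA2 cA3 cB1 cB2 cB3.
have [s1|] := boolP (A1 \subset B1); last exact: prism_diff_rung.
have [s1'|] := boolP (B1 \subset A1); last by move=> ?; apply: prism_swap; apply: prism_diff_rung.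
have [s2|n2] := boolP (A2 \subset B2); last by do 2!apply: prism_rot; apply: prism_diff_rung.
have [s2'|n2] := boolP (B2 \subset A2); last first.
  by apply: prism_swap; do 2!apply: prism_rot; apply: prism_diff_rung.
have [s3|n3] := boolP (A3 \subset B3); last by apply: prism_rot; apply: prism_diff_rung.
have [s3'|n3] := boolP (B3 \subset A3); last first.
  by apply: prism_swap; apply: prism_rot; apply: prism_diff_rung.
have /eqP e1 : A1 == B1 by rewrite eqEsubset s1.
have /eqP e2 : A2 == B2 by rewrite eqEsubset s2.
have /eqP e3 : A3 == B3 by rewrite eqEsubset s3.
subst B1 B2 B3.
have [s12|] := boolP (A1 \subset A2); last exact: prism_diff_triangle.
have [s23|n] := boolP (A2 \subset A3); last by do 2!apply: prism_rot; apply: prism_diff_triangle.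
have [s31|n] := boolP (A3 \subset A1); last by apply: prism_rot; apply: prism_diff_triangle.
have /card_gt2P[x [y [z [[xA yA zA] [xy yz zx]]]]] := cA1.
have [y2 z2] := (subsetP s12 y yA, subsetP s12 z zA).
have [x3 z3] := (subsetP s23 _ (subsetP s12 x xA), subsetP s23 _ z2).
by exists x, y, z, y, z, x; split=> //; split=> //; rewrite eq_sym.
Qed.
End Prism.

(** * Extending a colouring over an induced prism *)

Section PrismExtend.
Variables (V : finType) (h : rel V).
Hypotheses (h_sym : symmetric h) (h_irr : irreflexive h).
Variables (C : finType) (X : {set V}).
Hypothesis C7 : #|C| = 7.

(** Three of at most seven neighbours are uncoloured, so at most four of the seven colours are
    forbidden. *)
Lemma card_avail (c : V -> C) (U : {set V}) t n1 n2 n3 :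
  #|nbh h t| <= 7 -> [/\ n1 \in U, n2 \in U & n3 \in U] ->
  [/\ h t n1, h t n2 & h t n3] -> [/\ n1 != n2, n1 != n3 & n2 != n3] ->
  2 < #|~: (c @: (nbh h t :&: (X :\: U)))|.
Proof.
move=> t7 [U1 U2 U3] [h1 h2 h3] [n12 n13 n23].
have le : #|nbh h t :&: (X :\: U)| <= #|nbh h t :\ n1 :\ n2 :\ n3|.
  apply: subset_leq_card; apply/subsetP=> m; rewrite !inE => /and3P[hm mU _].
  by rewrite hm andbT; apply/and3P; split; apply: contraNneq mU => ->.
have e1 := cardsD1 n1 (nbh h t); have e2 := cardsD1 n2 (nbh h t :\ n1).
have e3 := cardsD1 n3 (nbh h t :\ n1 :\ n2).
have i1 : n1 \in nbh h t by rewrite inE.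
have i2 : n2 \in nbh h t :\ n1 by rewrite in_setD1 eq_sym n12 inE.
have i3 : n3 \in nbh h t :\ n1 :\ n2 by rewrite !in_setD1 eq_sym n23 eq_sym n13 inE.
rewrite i1 in e1; rewrite i2 in e2; rewrite i3 in e3.
have l4 : #|nbh h t :&: (X :\: U)| <= 4 by move: le e1 e2 e3 t7; clear; lia.
have := leq_trans (leq_imset_card c _) l4.
by have := cardsC (c @: (nbh h t :&: (X :\: U))); rewrite C7; clear; lia.
Qed.

Variables p1 p2 p3 e1 e2 e3 : V.
Hypotheses (pp12 : h p1 p2) (pp13 : h p1 p3) (pp23 : h p2 p3).
Hypotheses (ee12 : h e1 e2) (ee13 : h e1 e3) (ee23 : h e2 e3).
Hypotheses (pe1 : h p1 e1) (pe2 : h p2 e2) (pe3 : h p3 e3).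
Hypotheses (n12 : ~~ h p1 e2) (n13 : ~~ h p1 e3) (n21 : ~~ h p2 e1).
Hypotheses (n23 : ~~ h p2 e3) (n31 : ~~ h p3 e1) (n32 : ~~ h p3 e2).
Hypotheses (d12 : p1 != e2) (d13 : p1 != e3) (d21 : p2 != e1).
Hypotheses (d23 : p2 != e3) (d31 : p3 != e1) (d32 : p3 != e2).
Hypothesis deg7 : forall t, t \in [:: p1; p2; p3; e1; e2; e3] -> #|nbh h t| <= 7.
Let U := [set z in [:: p1; p2; p3; e1; e2; e3]].

Lemma prism_extend (c : V -> C) : coloring h (X :\: U) c -> exists c' : V -> C, coloring h X c'.
Proof.
move=> pc; pose s := [:: p1; p2; p3; e1; e2; e3].
have neq x y : h x y -> x != y by apply: contraTneq => ->; rewrite h_irr.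
have sy x y : h x y -> h y x by rewrite h_sym.
have sU n : n \in s -> n \in U by move=> ns; rewrite inE.
pose av t := ~: (c @: (nbh h t :&: (X :\: U))).
have avl t n1 n2 n3 : t \in s -> n1 \in s -> n2 \in s -> n3 \in s ->
    h t n1 -> h t n2 -> h t n3 -> n1 != n2 -> n1 != n3 -> n2 != n3 -> 2 < #|av t|.
  by move=> /deg7 t7 /sU u1 /sU u2 /sU u3 *; apply: (@card_avail _ _ _ n1 n2 n3).
have ms : [/\ p1 \in s, p2 \in s & p3 \in s] /\ [/\ e1 \in s, e2 \in s & e3 \in s].
  by split; split; rewrite !inE eqxx ?orbT.
case: ms => -[mp1 mp2 mp3] [me1 me2 me3].
have [pp21 pp31 pp32] := And3 (sy _ _ pp12) (sy _ _ pp13) (sy _ _ pp23).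
have [ee21 ee31 ee32] := And3 (sy _ _ ee12) (sy _ _ ee13) (sy _ _ ee23).
have [ep1 ep2 ep3] := And3 (sy _ _ pe1) (sy _ _ pe2) (sy _ _ pe3).
have [f12 f13 f23] := And3 (neq _ _ pp12) (neq _ _ pp13) (neq _ _ pp23).
have [k12 k13 k23] := And3 (neq _ _ ee12) (neq _ _ ee13) (neq _ _ ee23).
have [d11 d22 d33] := And3 (neq _ _ pe1) (neq _ _ pe2) (neq _ _ pe3).
have [d12' d13' d21'] : [/\ e2 != p1, e3 != p1 & e1 != p2] by split; rewrite eq_sym.
have [d23' d31' d32'] : [/\ e3 != p2, e1 != p3 & e2 != p3] by split; rewrite eq_sym.
have [||||||a1 [a2 [a3 [b1 [b2 [b3 [[a1A a2A a3A] [b1B b2B b3B] [a12 a13 a23] [b12 b13 b23]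
    [ab1 ab2 ab3]]]]]]]] := @prism_choosable C (av p1) (av p2) (av p3) (av e1) (av e2) (av e3).
- exact: (avl _ p2 p3 e1).
- exact: (avl _ p1 p3 e2).
- exact: (avl _ p1 p2 e3).
- exact: (avl _ e2 e3 p1).
- exact: (avl _ e1 e3 p2).
- exact: (avl _ e1 e2 p3).
pose d z := if z == p1 then a1 else if z == p2 then a2 else if z == p3 then a3 else
  if z == e1 then b1 else if z == e2 then b2 else b3.
have dp1 : d p1 = a1 by rewrite /d eqxx.
have dp2 : d p2 = a2 by rewrite /d eq_sym (negPf f12) eqxx.
have dp3 : d p3 = a3 by rewrite /d ![p3 == _]eq_sym (negPf f13) (negPf f23) eqxx.
have de1 : d e1 = b1.
  by rewrite /d [e1 == p1]eq_sym (negPf d11) (negPf d21') (negPf d31') eqxx.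
have de2 : d e2 = b2.
  by rewrite /d (negPf d12') [e2 == p2]eq_sym (negPf d22) (negPf d32') [e2 == e1]eq_sym
    (negPf k12) eqxx.
have de3 : d e3 = b3.
  by rewrite /d (negPf d13') (negPf d23') [e3 == p3]eq_sym (negPf d33) ![e3 == _]eq_sym
    (negPf k13) (negPf k23).
clearbody d.
have ds z : z \in U -> [\/ z = p1, z = p2 | z = p3] \/ [\/ z = e1, z = e2 | z = e3].
  rewrite !inE => /orP[|/orP[|/orP[|/orP[|/orP[]]]]] /eqP ->.
  - by left; constructor 1.
  - by left; constructor 2.
  - by left; constructor 3.
  - by right; constructor 1.
  - by right; constructor 2.
  - by right; constructor 3.
have pd : coloring h U d.
  move=> x y /ds[] [] -> /ds[] [] ->; rewrite ?h_irr // ?dp1 ?dp2 ?dp3 ?de1 ?de2 ?de3 => k //;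
    by [rewrite eq_sym | case/negP: n12; rewrite // h_sym | case/negP: n13; rewrite // h_sym
      | case/negP: n21; rewrite // h_sym | case/negP: n23; rewrite // h_sym
      | case/negP: n31; rewrite // h_sym | case/negP: n32; rewrite // h_sym].
have dav z : z \in U -> d z \in av z.
  by move=> /ds[] [] ->; rewrite ?dp1 ?dp2 ?dp3 ?de1 ?de2 ?de3.
exists (fun z => if z \in U then d z else c z).
apply: (@coloring_sub _ _ _ _ ((X :\: U) :|: U)).
  by apply/subsetP=> z zX; rewrite in_setU in_setD zX andbT orbC orbN.
apply: (coloring_setU h_sym) pc pd _ => x y xY yU _ hxy.
apply: contraTneq (dav y yU) => <-; rewrite in_setC negbK; apply: imset_f.
by rewrite in_setI xY andbT inE h_sym.
Qed.

End PrismExtend.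

(** * Conflicts around a triangle of the graph *)

Section Triangle.
Variables (T : finType) (g : rel T).
Hypotheses (g_sym : symmetric g) (g_irr : irreflexive g).
Hypothesis g_deg : forall v, #|[set u | g v u]| <= 3.
Local Notation N := (nbh (conf g)).

Lemma three_nbrs v a b c p : g v a -> g v b -> g v c -> a != b -> a != c -> b != c ->
  g v p -> [\/ p = a, p = b | p = c].
Proof.
move=> va vb vc ab ac bc vp.
have [->|pa] := eqVneq p a; first by constructor 1.
have [->|pb] := eqVneq p b; first by constructor 2.
have [->|pc] := eqVneq p c; first by constructor 3.
have /card_geqP : exists s, [/\ uniq s, size s = 4 & {subset s <= [set u | g v u]}].
  exists [:: p; a; b; c]; split=> //; first by rewrite /= !inE !negb_or pa pb pc ab ac bc.
  by move=> x; rewrite !inE => /or4P[]/eqP->.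
by move=> /leq_trans/(_ (g_deg v)).
Qed.

(** Both ends of [uw] lead to [v], and all edges reached through it lie in the star of [v]: at most
    three instead of 2 + 2. This is the saving that brings the degree down to 7. *)
Lemma tri_sub u v w : g u v -> g v w -> g u w -> N (edge u w) \subset
  star g v :|: (\bigcup_(p in nbrs_but g u w :\ v) star_but g p u :|:
                \bigcup_(p in nbrs_but g w u :\ v) star_but g p w).
Proof.
move=> uv vw uw; apply/subsetP=> f; rewrite nbh_edge // in_setU.
have in3 x y p q : g x p -> p != y -> g p q -> q != x ->
    edge p q \in star g v :|: \bigcup_(p in nbrs_but g x y :\ v) star_but g p x.
  move=> xp py pq qx; rewrite in_setU; have [pv|pv] := eqVneq p v.
    by rewrite pv in pq *; rewrite imset_f // inE.
  apply/orP; right; apply/bigcupP; exists p; last by apply/star_butP; exists q.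
  by rewrite in_setD1 pv; apply/nbrs_butP.
case/orP=> /edges_viaP[p [q [ap pb pq qa ->]]]; have := in3 _ _ _ _ ap pb pq qa;
  by rewrite !in_setU => /orP[]->; rewrite ?orbT.
Qed.

Lemma card_nbrs_but_tri u v w : g u v -> g u w -> v != w -> #|nbrs_but g u w :\ v| <= 1.
Proof.
move=> uv uw vw; have := card_nbrs_but g_deg uw; have := cardsD1 v (nbrs_but g u w).
have -> : v \in nbrs_but g u w by apply/nbrs_butP.
by clear; lia.
Qed.

Lemma tri_card u v w : g u v -> g v w -> g u w -> v != w -> v != u ->
  #|N (edge u w)| <= #|star g v| + 4.
Proof.
move=> uv vw uw nvw nvu; apply: leq_trans (subset_leq_card (tri_sub uv vw uw)) _.
apply: leq_trans (leq_card_setU _ _) _; rewrite leq_add2l.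
apply: leq_trans (leq_card_setU _ _) _; apply: (@leq_add _ _ 2 2).
  apply: leq_trans (card_bigcup_star_but g_sym g_deg _) _.
    by move=> p; rewrite !inE => /and3P[].
  by rewrite (leq_mul2l 2 _ 1) card_nbrs_but_tri.
apply: leq_trans (card_bigcup_star_but g_sym g_deg _) _.
    by move=> p; rewrite !inE => /and3P[].
by rewrite (leq_mul2l 2 _ 1) card_nbrs_but_tri //; side.
Qed.

Lemma tri_third u v w : g u v -> g v w -> g u w -> v != w -> v != u -> u != w ->
  7 <= #|N (edge u w)| -> exists v', [/\ g v v', v' != u & v' != w].
Proof.
move=> uv vw uw nvw nvu nuw c7; have := leq_trans c7 (tri_card uv vw uw nvw nvu).
have lS : #|star g v| <= #|[set p | g v p]| by exact: leq_imset_card.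
set A := [set p | g v p] in lS *; move=> l3.
have uA : u \in A by rewrite inE g_sym.
have wA : w \in A :\ u by rewrite in_setD1 eq_sym nuw inE.
have e1 := cardsD1 u A; have e2 := cardsD1 w (A :\ u); rewrite uA in e1; rewrite wA in e2.
have /card_gt0P[x] : 0 < #|A :\ u :\ w| by move: lS e1 e2 l3; card_lia.
by rewrite !inE => /and3P[xw xu vx]; exists x.
Qed.

(** A second common neighbour [p] would confine all conflicts of [uw] to the stars of [v] and [p],
    at most six edges. *)
Lemma tri_apart u v w p : g u v -> g v w -> g u w -> v != w -> v != u ->
  7 <= #|N (edge u w)| -> g u p -> g w p -> p != v -> False.
Proof.
move=> uv vw uw nvw nvu c7 up wp pv.
have pu : p != u by apply: contraTneq up => ->; rewrite g_irr.
have pw : p != w by apply: contraTneq wp => ->; rewrite g_irr.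
have one x y : g x v -> g x y -> v != y -> g x p -> p != y ->
    nbrs_but g x y :\ v = [set p].
  move=> xv xy vy xp py; apply/eqP; rewrite eq_sym eqEcard sub1set cards1.
  rewrite card_nbrs_but_tri // andbT.
  by rewrite in_setD1 pv /=; apply/nbrs_butP.
have := subset_leq_card (tri_sub uv vw uw).
have wv : g w v by side.
have wu : g w u by side.
rewrite !one //.
rewrite !big_set1 => le.
have s1 : star g v :|: (star_but g p u :|: star_but g p w) \subset star g v :|: star g p.
  apply: setUS; rewrite subUset; apply/andP; split; apply/subsetP=> f /star_butP[q [pq _] ->];
    by apply: imset_f; rewrite inE.
have := leq_trans c7 (leq_trans le (subset_leq_card s1)).
have := leq_card_setU (star g v) (star g p).
have := card_star g_deg v; have := card_star g_deg p.
by move=> l1 l2 [l3 _]; move: l1 l2 l3; card_lia.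
Qed.

(** Seen from [u], the opposite side [vw] is reached both through [v] and through [w], so that end
    contributes three conflicts instead of four. *)
Lemma pendant_card u v w u' v' w' :
  g u v -> g v w -> g u w -> g u u' -> g v v' -> g w w' ->
  u' != v -> u' != w -> v' != u -> v' != w -> w' != u -> w' != v ->
  u != v -> v != w -> u != w -> #|N (edge u u')| <= 7.
Proof.
move=> uv vw uw uu vv ww u'v u'w v'u v'w w'u w'v nuv nvw nuw.
rewrite nbh_edge //; apply: leq_trans (leq_card_setU _ _) _.
apply: (@leq_add _ _ 3 4); last by apply: card_edges_via; rewrite // g_sym.
apply: leq_trans (_ : #|[set edge v w; edge v v'; edge w w']| <= _); last first.
  by apply: leq_trans (leq_card_setU _ _) _; rewrite cards1 cards2; case: (_ != _).
apply: subset_leq_card; apply/subsetP=> f /edges_viaP[p [q [up pu pq qu ->]]]; rewrite !inE.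
have [|||||||ep|ep|ep] := @three_nbrs u v w u' p; try side.
- subst p; have [|||||||e|e|e] := @three_nbrs v u w v' q; try side.
  + by rewrite e eqxx in qu.
  + by rewrite e eqxx.
  + by rewrite e eqxx orbT.
- subst p; have [|||||||e|e|e] := @three_nbrs w u v w' q; try side.
  + by rewrite e eqxx in qu.
  + by rewrite e edgeC eqxx.
  + by rewrite e eqxx !orbT.
- by rewrite ep eqxx in pu.
Qed.

Lemma tri_extend (C : finType) (X : {set {set T}}) u v w : #|C| = 7 ->
  (forall m, m \in X -> 7 <= #|N m :&: X|) -> g u v -> g v w -> g u w -> edge u w \in X ->
  (forall Y : {set {set T}}, Y \proper X -> exists c : {set T} -> C, coloring (conf g) Y c) ->
  exists c : {set T} -> C, coloring (conf g) X c.
Proof.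
move=> C7 X7 uv vw uw uwX IH.
have irr a b : g a b -> a != b by apply: contraTneq => ->; rewrite g_irr.
have [nuv nvw nuw] : [/\ u != v, v != w & u != w] by split; apply: irr.
have [nvu nwv nwu] : [/\ v != u, w != v & w != u] by split; side.
have [vu wv wu] : [/\ g v u, g w v & g w u] by split; side.
have deg7 a b c : g a b -> g b c -> g a c -> b != c -> b != a -> #|N (edge a c)| <= 7.
  move=> ab bc ac nbc nba; apply: leq_trans (tri_card ab bc ac nbc nba) _.
  exact: (leq_add (card_star g_deg b) (leqnn 4)).
have geX m : m \in X -> 7 <= #|N m|.
  by move=> mX; apply: leq_trans (X7 m mX) _; apply: subset_leq_card; apply: subsetIl.
(* [uw] has at most seven conflicts in all and at least seven in [X], so all of them are in [X];
   this brings the other two sides of the triangle into [X]. *)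
have sX m : conf g (edge u w) m -> m \in X.
  have /eqP e : N (edge u w) :&: X == N (edge u w).
    by rewrite eqEcard subsetIl (leq_trans (deg7 u v w _ _ _ _ _)) // X7.
  by move=> hm; have : m \in N (edge u w); [rewrite inE | rewrite -e inE => /andP[]].
have uvX : edge u v \in X by apply: sX; rewrite edgeC (edgeC u); apply: confI; side.
have vwX : edge v w \in X by apply: sX; apply: confI; side.
have [v' [vv v'u v'w]] := tri_third uv vw uw nvw nvu nuw (geX _ uwX).
have [w' [ww w'u w'v]] := tri_third uw wv uv nwv nwu nuv (geX _ uvX).
have [u' [uu u'v u'w]] := tri_third vu uw vw nuw nuv nvw (geX _ vwX).
have noU p : g u p -> g w p -> p != v -> False := tri_apart uv vw uw nvw nvu (geX _ uwX).
have noW p : g u p -> g v p -> p != w -> False := tri_apart uw wv uv nwv nwu (geX _ uvX).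
have noV p : g v p -> g w p -> p != u -> False := tri_apart vu uw vw nuw nuv (geX _ vwX).
(* Index i pairs a pendant edge with the opposite side of the triangle. A conflict with a side at
   its own vertex would need a second common neighbour of two corners, excluded by [noU], [noW] and
   [noV]. *)
pose p1 := edge u u'; pose p2 := edge v v'; pose p3 := edge w w'.
pose e1 := edge v w; pose e2 := edge u w; pose e3 := edge u v.
have pp12 : conf g p1 p2 by apply: confI; side.
have pp13 : conf g p1 p3 by apply: confI; side.
have pp23 : conf g p2 p3 by apply: confI; side.
have ee12 : conf g e1 e2 by apply: confI; side.
have ee13 : conf g e1 e3 by rewrite /e1 (edgeC v); apply: confI; side.
have ee23 : conf g e2 e3 by rewrite /e2 /e3 !(edgeC u); apply: confI; side.
have pe1 : conf g p1 e1 by apply: confI; side.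
have pe2 : conf g p2 e2 by apply: confI; side.
have pe3 : conf g p3 e3 by apply: confI; side.
have apart a b c : conf g (edge a b) (edge a c) -> g b c := @conf_share _ _ g_irr a b c.
have n12 : ~~ conf g p1 e2 by apply/negP => /apart k; apply: (noU u'); side.
have n13 : ~~ conf g p1 e3 by apply/negP => /apart k; apply: (noW u'); side.
have n21 : ~~ conf g p2 e1 by apply/negP => /apart k; apply: (noV v'); side.
have n23 : ~~ conf g p2 e3.
  by rewrite /e3 edgeC; apply/negP => /apart k; apply: (noW v'); side.
have n31 : ~~ conf g p3 e1.
  by rewrite /e1 edgeC; apply/negP => /apart k; apply: (noV w'); side.
have n32 : ~~ conf g p3 e2.
  by rewrite /e2 edgeC; apply/negP => /apart k; apply: (noU w'); side.
have nep a b c : g a b -> b != c -> edge a b != edge a c.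
  by move=> ab bc; rewrite edgeC; apply: edge_neq; rewrite // eq_sym irr.
have d12 : p1 != e2 by apply: nep.
have d13 : p1 != e3 by apply: nep.
have d21 : p2 != e1 by apply: nep.
have d23 : p2 != e3 by rewrite /e3 edgeC; apply: nep.
have d31 : p3 != e1 by rewrite /e1 edgeC; apply: nep.
have d32 : p3 != e2 by rewrite /e2 edgeC; apply: nep.
have confC := conf_sym g_sym.
pose U := [set z in [:: p1; p2; p3; e1; e2; e3]].
have [c pc] : exists c : {set T} -> C, coloring (conf g) (X :\: U) c.
  apply: IH; apply/properP; split; first exact: subsetDl.
  by exists e2 => //; rewrite !inE eqxx !orbT.
apply: (@prism_extend _ _ confC (conf_irr g_irr) C X C7 p1 p2 p3 e1 e2 e3) pc => // t.
rewrite !inE => /orP[|/orP[|/orP[|/orP[|/orP[]]]]] /eqP ->.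
- by apply: (pendant_card (v := v) (w := w) (v' := v') (w' := w')); side.
- by apply: (pendant_card (v := u) (w := w) (v' := u') (w' := w')); side.
- by apply: (pendant_card (v := u) (w := v) (v' := u') (w' := v')); side.
- by apply: (deg7 _ u).
- by apply: (deg7 _ v).
- by apply: (deg7 _ w).
Qed.

End Triangle.

(** * The bound *)

Section Subcubic.
Variables (T : finType) (g : rel T).
Hypotheses (g_sym : symmetric g) (g_irr : irreflexive g).
Hypothesis g_deg : forall v, #|[set u | g v u]| <= 3.
Local Notation N := (nbh (conf g)).
Local Notation color := ('I_3 + 'I_4)%type.

(** Stated for every set of edges while conflicts stay those of the whole graph: the induction
    removes edges from [X] without changing the conflict relation. *)
Lemma conf_colorable (X : {set {set T}}) :
  (forall m, m \in X -> exists a b, g a b /\ m = edge a b) ->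
  exists c : {set T} -> color, coloring (conf g) X c.
Proof.
have C7 : #|{: color}| = 7 by rewrite card_sum !card_ord.
have confC := conf_sym g_sym; have confI := conf_irr g_irr.
have [n] := ubnP #|X|; elim: n X => // n IHn X ltX X_edge.
have IH (Y : {set {set T}}) : Y \proper X -> exists c : {set T} -> color, coloring (conf g) Y c.
  move=> pYX; apply: IHn; first by apply: leq_trans (proper_card pYX) _; rewrite -ltnS.
  by move=> m /(subsetP (proper_sub pYX))/X_edge.
have [/existsP[m /andP[mX dm]]|/existsPn X_deg] :=
  boolP [exists m, (m \in X) && (#|N m :&: X| < 7)].
  have [c pc] := IH _ (properD1 mX).
  have [|c' pc' _] := @coloring_extend _ _ confC confI _ (X :\ m) c m pc.
    rewrite C7; apply: leq_ltn_trans (leq_imset_card _ _) _.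
    apply: leq_ltn_trans dm; apply: subset_leq_card; apply: setIS; exact: subD1set.
  by exists c'; rewrite setD1K in pc'.
have {}X_deg m : m \in X -> 7 <= #|N m :&: X|.
  by move=> mX; move: (X_deg m); rewrite mX /= -leqNgt.
have [/existsP[u /existsP[v /existsP[w /and4P[uw wv uv uvX]]]]|notri] :=
  boolP [exists u, exists v, exists w, [&& g u w, g w v, g u v & edge u v \in X]].
  exact: (@tri_extend _ _ g_sym g_irr g_deg _ X u w v).
have X_tri u v w : g u v -> g v w -> g u w -> edge u v \notin X.
  move=> uv vw uw; apply: contraNN notri => uvX; apply/existsP; exists u; apply/existsP.
  by exists v; apply/existsP; exists w; rewrite uw g_sym vw uv.
have [V1 [V1X opt1 opt2]] := lovasz_partition confC confI X.
have [|m|m|K sK cK|Q e sQ cQ Q4 eQ|c pc] :=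
    @split_coloring _ _ confC confI V1 (X :\: V1).
- by rewrite disjoint_sym disjoints_subset setDE subsetIr.
- exact: (deg_V1 g_sym g_deg X_edge V1X opt1).
- exact: (deg_V2 g_sym g_deg X_edge V1X opt2).
- rewrite leqNgt; apply/negP => K5.
  have K5' : #|K| = 5.
    apply/eqP; rewrite eqn_leq K5 andbT.
    have /card_gt0P[x xK] : 0 < #|K| by apply: leq_trans K5.
    have := deg_V2 g_sym g_deg X_edge V1X opt2 (subsetP sK x xK).
    have := cardsD1 x K; rewrite xK add1n => ->; rewrite ltnS; apply: leq_trans.
    apply: subset_leq_card; apply/subsetP=> y; rewrite !inE => /andP[yx yK].
    by move: (subsetP sK y yK); rewrite inE => ->; rewrite andbT cK // eq_sym.
  exact: (K5_false g_sym g_irr g_deg X_edge X_tri V1X opt1 opt2 X_deg sK cK).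
- split; last exact: (K4_swappable g_sym g_irr g_deg X_edge X_tri V1X opt1 opt2).
  by rewrite (card_Q_V2 (V1 := V1) (Q := Q) g_sym g_deg X_edge V1X opt1).
exists c; apply: coloring_sub pc; apply/subsetP=> m mX.
by rewrite in_setU in_setD mX andbT orNb.
Qed.

Lemma edge_of_is_edge E : is_edge g E -> exists a b, g a b /\ E = edge a b.
Proof. by case/existsP=> a /existsP[b /andP[ab /eqP->]]; exists a, b. Qed.

Lemma conf_of_dist1 e f : is_edge g e -> is_edge g f -> edges_dist1 g e f -> conf g e f.
Proof.
move=> /edge_of_is_edge[a [b [ab ->]]] /edge_of_is_edge[c [d [cd ->]]].
case/andP=> dis /exists_inP[u ue /exists_inP[v vf uv]].
have [p up ep] := edge_at g_sym ab ue; have [q vq eq] := edge_at g_sym cd vf.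
rewrite ep eq in dis *; apply: confI => //.
  apply: contraTneq dis => pv; apply/pred0Pn; exists v.
  by rewrite /= -pv set22 pv set21.
apply: contraTneq dis => qu; apply/pred0Pn; exists u.
by rewrite /= -qu set22 qu set21.
Qed.

(** Two edges within three vertices share some [p]; the path witnessing the conflict is the closed
    one p-q-r-p. *)
Lemma conf_of_triangle e f : is_edge g e -> is_edge g f -> e != f ->
  in_common_triangle g e f -> conf g e f.
Proof.
move=> /edge_of_is_edge[a [b [ab ->]]] /edge_of_is_edge[c [d [cd ->]]] ne.
case/existsP=> x /existsP[y /existsP[z /and4P[xy yz xz /andP[sab scd]]]].
have adj p q : p \in [set x; y; z] -> q \in [set x; y; z] -> p != q -> g p q.
  by rewrite !inE -!orbA => /or3P[]/eqP-> /or3P[]/eqP->; rewrite ?eqxx // g_sym.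
have [p pab pcd] : exists2 p, p \in edge a b & p \in edge c d.
  have [/existsP[p /andP[]]|/existsPn none] :=
    boolP [exists p, (p \in edge a b) && (p \in edge c d)]; first by exists p.
  have no p q : p \in edge a b -> q \in edge c d -> p != q.
    by move=> pab qcd; apply: contraNneq (none p) => epq; rewrite pab epq qcd.
  have u4 : uniq [:: a; b; c; d].
    have irr p q : g p q -> p != q by apply: contraTneq => ->; rewrite g_irr.
    rewrite /= !inE !negb_or (irr a b) // (irr c d) //.
    by rewrite !no ?set21 ?set22.
  have /(uniq_leq_size u4) // : {subset [:: a; b; c; d] <= [:: x; y; z]}.
  move=> p; rewrite !inE => /or4P[]/eqP->.
  - by move: (subsetP sab a (set21 _ _)); rewrite !inE -!orbA.
  - by move: (subsetP sab b (set22 _ _)); rewrite !inE -!orbA.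
  - by move: (subsetP scd c (set21 _ _)); rewrite !inE -!orbA.
  - by move: (subsetP scd d (set22 _ _)); rewrite !inE -!orbA.
have [q pq eq] := edge_at g_sym ab pab; have [r pr er] := edge_at g_sym cd pcd.
have qr : q != r by apply: contraNneq ne => eqr; rewrite eq er eqr.
have gqr : g q r.
  apply: adj qr; [apply: (subsetP sab) | apply: (subsetP scd)].
    by rewrite -/(edge a b) eq set22.
  by rewrite -/(edge c d) er set22.
rewrite eq er !(edgeC p); apply: confI => //; rewrite 1?g_sym //.
  by apply: contraTneq pr => ->; rewrite g_irr.
by apply: contraTneq pq => ->; rewrite g_irr.
Qed.

End Subcubic.

Theorem theorem1p4 (T : finType) (g : rel T) :
  simple_graph g -> max_degree_le g 3 -> inj_chromatic_index_le g 7.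
Proof.
move=> [g_sym g_irr] g_deg.
have [|c pc] := @conf_colorable T g g_sym g_irr g_deg [set E | is_edge g E].
  by move=> m; rewrite inE => /edge_of_is_edge.
(* [unsplit] injects the two palettes into ['I_(3 + 4)], which is ['I_7] by computation. *)
exists (fun E => unsplit (c E) : 'I_7) => e f ee ef ne ed.
rewrite (can_eq (@unsplitK 3 4)); apply: pc; rewrite ?inE //.
by case/orP: ed => [/conf_of_dist1|/conf_of_triangle]; apply.
Qed.
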